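(* Let $L>1$ and $p\ge n$. There exist some $c>0$ in the model selection prior $\lambda_n((k,s))\propto\exp(-c\,ks\log(ep))$, $(k,s)\in\mathbb N^2$, some sequence of (sieve) priors $\Pi_{n,(k,s)}$ on $\mathfrak M_{(k,s)}$ depending on $L$, and constants $C_1,C_2>0$ depending on $L$, such that $$P_{\Sigma_0}^{(n)}\Pi_n\big(\Sigma\in\mathfrak M:\|\Sigma-\Sigma_0\|_F^2>C_1(\epsilon_{n,(k,s)}^{\mathrm{cov}})^2\,\big|\,X^{(n)}\big)\le C_2e^{-n(\epsilon_{n,(k,s)}^{\mathrm{cov}})^2/C_2},$$ where $$(\epsilon_{n,(k,s)}^{\mathrm{cov}})^2\equiv\max\Big\{\inf_{\Sigma'\in\mathfrak M_{(k,s)}}\|\Sigma'-\Sigma_0\|_F^2,\ \frac{ks\log(ep)}{n}\Big\}.$$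
   Context: Observations $X_1,\dots,X_n\in\mathbb R^p$ are i.i.d. $\mathcal N_p(0,\Sigma_0)$, $X^{(n)}=(X_1,\dots,X_n)$, where $\Sigma_0\in\mathscr S_p(L)$, the set of $p\times p$ covariance matrices whose minimal and maximal eigenvalues are bounded by $L^{-1}$ (below) and $L$ (above); $P_{\Sigma_0}^{(n)}$ is the corresponding expectation. $\|\cdot\|_F$ is the Frobenius norm. Sparse factor model: $\mathfrak M=\bigcup_{(k,s)\in\mathbb N^2}\mathfrak M_{(k,s)}$ with $\mathfrak M_{(k,s)}=\{\Sigma=\Lambda\Lambda^\top+I:\Lambda\in\mathscr R_{(k,s)}(L)\}$ and $\mathscr R_{(k,s)}(L)=\{\Lambda\in\mathbb R^{p\times k}:\Lambda_{\cdot j}\in B_0(s),\ |\sigma_j(\Lambda)|\le L^{1/2}\ \forall\,1\le j\le k\}$, where $\Lambda_{\cdot j}$ is the $j$-th column, $\sigma_j$ the $j$-th singular value, and $B_0(s)=\{v\in\mathbb R^p:|\mathrm{supp}(v)|\le s\}$. The overall prior is $\Pi_n=\sum_{(k,s)}\lambda_n((k,s))\Pi_{n,(k,s)}$ and $\Pi_n(\cdot\mid X^{(n)})$ is the posterior. A ''sieve prior'' is a prior constructed using the metric entropy (a covering) of $\mathfrak M_{(k,s)}$. *)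

(* Defs.v *)
From HB Require Import structures.
From mathcomp Require Import all_boot all_order all_algebra.
From mathcomp Require Import all_classical all_reals all_analysis.
Set Implicit Arguments.
Unset Strict Implicit.
Unset Printing Implicit Defensive.
Import Order.TTheory GRing.Theory Num.Theory.
Import numFieldNormedType.Exports.

Local Open Scope classical_set_scope.
Local Open Scope ring_scope.

Section tuple_power.
Context d (T : measurableType d) (R : realType).

Definition cons_pair n (z : T * n.-tuple T) : n.+1.-tuple T :=
  [the n.+1.-tuple T of z.1 :: z.2].

Lemma measurable_cons_pair n : measurable_fun setT (@cons_pair n).
Proof. exact: measurable_cons. Qed.

Section step.
Variables (mu : {sigma_finite_measure set T -> \bar R}) (n : nat).
Variable nu : {sigma_finite_measure set (n.-tuple T) -> \bar R}.

Definition tuple_step : set (n.+1.-tuple T) -> \bar R :=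
  pushforward (mu \x nu)%E (@cons_pair n).

Let tuple_step0 : tuple_step set0 = 0%E.
Proof. by rewrite /tuple_step /pushforward preimage_set0 measure0. Qed.

Let tuple_step_ge0 A : (0 <= tuple_step A)%E.
Proof. by rewrite /tuple_step /pushforward measure_ge0. Qed.

Let tuple_step_sigma_additive : semi_sigma_additive tuple_step.
Proof.
move=> F mF tF mUF; rewrite /tuple_step /pushforward preimage_bigcup.
have mc := @measurable_cons_pair n.
apply: measure_semi_sigma_additive.
- by move=> i; rewrite -[X in measurable X]setTI; exact: mc.
- apply/trivIsetP => /= i j _ _ ij; rewrite -preimage_setI.
  by move/trivIsetP : tF => /(_ _ _ _ _ ij) ->//; rewrite preimage_set0.
- by rewrite -preimage_bigcup -[X in measurable X]setTI; exact: mc.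
Qed.

HB.instance Definition _ := isMeasure.Build _ _ _ tuple_step
  tuple_step0 tuple_step_ge0 tuple_step_sigma_additive.

Lemma tuple_step_sigma_finite : sigma_finite setT tuple_step.
Proof.
have /sigma_finiteP[F [FT ndF mF]] := sigma_finiteT mu.
have /sigma_finiteP[G [GT ndG mG]] := sigma_finiteT nu.
pose h (t : n.+1.-tuple T) := (tnth t ord0, [tuple of behead t]).
have mh : measurable_fun setT h.
  by apply/measurable_fun_pair; [exact: measurable_tnth|exact: measurable_behead].
have hK : forall z, h (cons_pair z) = z.
  by move=> [x y]; rewrite /h; congr pair; apply/val_inj.
exists (fun i => h @^-1` (F i `*` G i)).
  apply/esym; rewrite -subTset => t _.
  have [i _ Fi] : (\bigcup_i F i) (h t).1 by rewrite -FT.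
  have [j _ Gj] : (\bigcup_i G i) (h t).2 by rewrite -GT.
  exists (maxn i j) => //; split.
    by have /subsetPset := ndF _ _ (leq_maxl i j); exact.
  by have /subsetPset := ndG _ _ (leq_maxr i j); exact.
move=> i; split.
  rewrite -[X in measurable X]setTI; apply: mh => //.
  by apply: measurableX; [exact: (mF i).1|exact: (mG i).1].
have hE : @cons_pair n @^-1` (h @^-1` (F i `*` G i)) = F i `*` G i.
  by apply/funext => z; rewrite /preimage /mkset hK.
rewrite /tuple_step /pushforward hE.
rewrite product_measure1E; [|exact: (mF i).1|exact: (mG i).1].
by apply: lte_mul_pinfty; [|rewrite ge0_fin_numE//; exact: (mF i).2|exact: (mG i).2].
Qed.

HB.instance Definition _ :=
  Measure_isSigmaFinite.Build _ _ _ tuple_step tuple_step_sigma_finite.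

End step.

Fixpoint tuple_measure (mu : {sigma_finite_measure set T -> \bar R}) (n : nat) :
    {sigma_finite_measure set (n.-tuple T) -> \bar R} :=
  match n with
  | 0 => \d_([tuple] : 0.-tuple T)
  | m.+1 => tuple_step mu (tuple_measure mu m)
  end.

End tuple_power.

Section normal_model.
Variable R : realType.
Implicit Types p n : nat.

Definition Rvec p := p.-tuple (measurableTypeR R).

HB.instance Definition _ p := Measurable.on (Rvec p).

Definition lebesgue_Rvec p : set (Rvec p) -> \bar R :=
  tuple_measure (@lebesgue_measure R) p.

HB.instance Definition _ p := SigmaFiniteMeasure.on (@lebesgue_Rvec p).

Definition col_of_Rvec p (x : Rvec p) : 'cV[R]_p := \col_i tnth x i.

(* N_p(0, S) density; only meant for positive definite S *)
Definition mvnormal_pdf p (S : 'M[R]_p) (x : Rvec p) : R :=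
  (Num.sqrt ((2 * pi) ^+ p * \det S))^-1 *
  expR (- ((col_of_Rvec x)^T *m invmx S *m col_of_Rvec x) 0 0 / 2).

Definition mvnormal_prob p (S : 'M[R]_p) (A : set (Rvec p)) : \bar R :=
  (\int[@lebesgue_Rvec p]_(x in A) (mvnormal_pdf S x)%:E)%E.

Definition mutually_independent d (W : measurableType d) (P : probability W R)
    p n (X : 'I_n -> {RV P >-> Rvec p}) : Prop :=
  forall A : 'I_n -> set (Rvec p), (forall i, measurable (A i)) ->
    P (\bigcap_(i in [set: 'I_n]) (X i @^-1` A i)) =
    (\prod_(i < n) P (X i @^-1` A i))%E.

Definition iid_mvnormal d (W : measurableType d) (P : probability W R)
    p n (X : 'I_n -> {RV P >-> Rvec p}) (S : 'M[R]_p) : Prop :=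
  mutually_independent X /\
  forall i A, measurable A -> distribution P (X i) A = mvnormal_prob S A.

Definition likelihood p n (x : 'I_n -> Rvec p) (S : 'M[R]_p) : R :=
  \prod_(i < n) mvnormal_pdf S (x i).

(* 'M[R]_p with its Borel sigma-algebra *)
Definition mxBorel p := g_sigma_algebraType (@open 'M[R]_p).

HB.instance Definition _ p := Measurable.on (mxBorel p).

Definition posterior p n (Pi : {measure set (mxBorel p) -> \bar R})
    (x : 'I_n -> Rvec p) (B : set 'M[R]_p) : R :=
  Rintegral Pi (B : set (mxBorel p)) (likelihood x) /
  Rintegral Pi setT (likelihood x).

Definition frobenius m n (A : 'M[R]_(m, n)) : R :=
  Num.sqrt (\sum_i \sum_j A i j ^+ 2).

Definition covariance_mx p (S : 'M[R]_p) : Prop :=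
  S^T = S /\ forall v : 'rV[R]_p, 0 <= (v *m S *m v^T) 0 0.

Definition cov_class p (L : R) : set 'M[R]_p :=
  [set S | covariance_mx S /\ forall a, eigenvalue S a -> L^-1 <= a <= L].

End normal_model.

Section sparse_factor_model.
Variables (R : realType) (p : nat) (L : R).

(* the k singular values of A, those equal to 0 included when k > p; the bound
   on all sigma_j is a bound on the set of these values *)
Definition singular_value k (A : 'M[R]_(p, k)) (sigma : R) : Prop :=
  0 <= sigma /\ eigenvalue (A^T *m A) (sigma ^+ 2).

Definition B0 (s : nat) : set 'cV[R]_p :=
  [set v | (#|[pred i : 'I_p | v i 0%R != 0%R]| <= s)%N].

Definition loading_class (k s : nat) : set 'M[R]_(p, k) :=
  [set A | (forall j, B0 s (col j A)) /\
           forall sigma, singular_value A sigma -> `|sigma| <= Num.sqrt L].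

Definition factor_model (k s : nat) : set 'M[R]_p :=
  [set A *m A^T + 1%:M | A in @loading_class k s].

(* the index set is that of positive integers: over pairs containing a zero
   the prior weights exp(- c k s log(e p)) would not be summable *)
Definition factor_models : set 'M[R]_p :=
  [set S | exists k s, [/\ (0 < k)%N, (0 < s)%N & factor_model k s S]].

Definition complexity (k s : nat) : R :=
  (k * s)%:R * ln (expR 1 * p%:R).

Definition rate2 (n k s : nat) (S0 : 'M[R]_p) : R :=
  Num.max (inf [set frobenius (S - S0) ^+ 2 | S in factor_model k s])
          (complexity k s / n%:R).

Definition model_weight (c : R) (k s : nat) : R :=
  expR (- c * complexity k s).

Definition total_weight (c : R) : \bar R :=
  (\sum_(1 <= k <oo) \sum_(1 <= s <oo) (model_weight c k s)%:E)%E.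

Definition model_prior (c : R) (k s : nat) : R :=
  model_weight c k s / fine (total_weight c).

Lemma model_prior_ge0 c k s : 0 <= model_prior c k s.
Proof.
apply: divr_ge0; first exact: expR_ge0.
apply/fine_ge0/nneseries_ge0 => i _ _.
by apply: nneseries_ge0 => j _ _; rewrite lee_fin expR_ge0.
Qed.

(* [mseries _ 1] sums from index 1 *)
Definition overall_prior (c : R) (Pi : nat -> nat -> probability (mxBorel R p) R)
    : set (mxBorel R p) -> \bar R :=
  mseries (fun k =>
    mseries (fun s => mscale (NngNum (model_prior_ge0 c k s)) (Pi k s)) 1) 1.

HB.instance Definition _ c Pi := Measure.on (@overall_prior c Pi).

Definition frobenius_net (F : set 'M[R]_p) (r : R) (N : seq 'M[R]_p) : Prop :=
  (forall S, S \in N -> F S) /\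
  (forall S, F S -> exists2 S', S' \in N & frobenius (S - S') <= r).

(* uniform distribution on a minimal covering of F by Frobenius balls *)
Definition sieve_prior (F : set 'M[R]_p) (Pi : probability (mxBorel R p) R)
    : Prop :=
  exists (r : R) (N : seq 'M[R]_p),
    [/\ 0 < r,
        frobenius_net F r N,
        (forall N', frobenius_net F r N' -> (size N <= size N')%N) &
        forall A : set (mxBorel R p), measurable A ->
          Pi A = ((size N)%:R^-1%:E * \sum_(S <- N) \d_(S : mxBorel R p) A)%E].

End sparse_factor_model.

(* Main.v *)
Require Import Defs.
From HB Require Import structures.
From mathcomp Require Import all_boot all_order all_algebra.
From mathcomp Require Import all_classical all_reals all_analysis.
From mathcomp Require Import measurable_realfun complex ring lra.
Set Implicit Arguments.
Unset Strict Implicit.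
Unset Printing Implicit Defensive.
Import Order.TTheory GRing.Theory Num.Theory.
Import numFieldNormedType.Exports.

(** The sieve priors are sums of atoms, so the posterior is a ratio of weighted sums of
    likelihoods, and its expectation can be bounded atom by atom. Let [S1] be an atom of the
    model [(k, s)] close to the truth [S0], and let [0 < al < 1]. The normalising integral
    is at least the term of [S1], every term of the posterior lies in the unit interval, and
    [t <= t ^ al] there; hence the posterior mass of a set [B] is at most the sum, over the
    atoms [S] in [B] of all models, of the ratios [(w_S f_S / (w_S1 f_S1)) ^ al] of weighted
    likelihoods ([posterior_le_sum]).

    The expectation under [S0] of such a power is a Gaussian integral
    ([expectation_fractional_ratio]). With [A = S^-1], [A1 = S1^-1], [A0 = S0^-1] and
    [Q = A0 + al (A - A1)] it is the exponential of [n / 2] times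
    [al (ln det A - ln det A1) + ln det A0 - ln det Q]. On matrices with bounded spectrum
    [ln det] lies between two parabolas below its tangent ([logdet_le], [logdet_ge]), the
    terms of first order cancel, and for [al] small in terms of [L] the expression is at most
    [al (k2 |S1 - S0|^2 - k1 |S - S0|^2)] ([fractional_logdet]). So an atom at squared
    distance more than [C1] times the rate contributes an exponentially small amount, while
    [S1] itself is within a constant times the rate ([exists_oracle_atom]).

    It remains to count. A loading matrix is coded by the positions of its nonzero entries and
    by these entries rounded to a grid of mesh of order [1 / n]; matrices with equal codes are
    close enough, and as [n <= p] there are at most [exp (K h)] codes, [h] the complexity of
    the model ([exists_sieve]). The weight [exp (- c h)] raised to the power [al], with
    [al c = K + 1], outweighs this number and leaves [exp (- h)], which is summable over all
    models ([nneseries2_complexity_le]). *)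

Local Open Scope classical_set_scope.
Local Open Scope ring_scope.

(** * Frobenius norm and quadratic forms *)

Section quadratic_forms.
Variable R : rcfType.

Definition fro2 m n (A : 'M[R]_(m, n)) : R := \sum_i \sum_j A i j ^+ 2.

Definition qform n (S : 'M[R]_n) (v : 'rV[R]_n) : R := (v *m S *m v^T) 0 0.

Lemma fro2E m n (A : 'M[R]_(m, n)) : fro2 A = \tr (A *m A^T).
Proof.
by apply: eq_bigr => i _; rewrite mxE; apply: eq_bigr => j _; rewrite mxE expr2.
Qed.

Lemma fro2_ge0 m n (A : 'M[R]_(m, n)) : 0 <= fro2 A.
Proof. by do 2!apply: sumr_ge0 => ? _; rewrite sqr_ge0. Qed.

Lemma fro2_tr m n (A : 'M[R]_(m, n)) : fro2 A^T = fro2 A.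
Proof. by rewrite !fro2E trmxK mxtrace_mulC. Qed.

Lemma fro2N m n (A : 'M[R]_(m, n)) : fro2 (- A) = fro2 A.
Proof. by apply: eq_bigr => i _; apply: eq_bigr => j _; rewrite mxE sqrrN. Qed.

Lemma fro2_row m n (A : 'M[R]_(m, n)) : fro2 A = \sum_i fro2 (row i A).
Proof.
apply: eq_bigr => i _; rewrite /fro2 big_ord1.
by apply: eq_bigr => j _; rewrite mxE.
Qed.

Lemma fro2_orthogonal m n (A : 'M[R]_(m, n)) (U : 'M[R]_n) :
  U *m U^T = 1%:M -> fro2 (A *m U) = fro2 A.
Proof. by move=> UU; rewrite !fro2E trmx_mul mulmxA -(mulmxA A) UU mulmx1. Qed.

Lemma fro2D m n (A B : 'M[R]_(m, n)) :
  fro2 (A + B) <= 2 * fro2 A + 2 * fro2 B.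
Proof.
rewrite /fro2 !mulr_sumr -big_split; apply: ler_sum => i _ /=.
rewrite !mulr_sumr -big_split; apply: ler_sum => j _ /=.
by rewrite mxE; have := sqr_ge0 (A i j - B i j); nra.
Qed.

Lemma qform_fro2 n (v : 'rV[R]_n) : qform 1%:M v = fro2 v.
Proof. by rewrite /qform mulmx1 fro2E /mxtrace big_ord1. Qed.

Lemma qform_conj m n (S : 'M[R]_n) (T : 'M[R]_(m, n)) v :
  qform (T *m S *m T^T) v = qform S (v *m T).
Proof. by rewrite /qform trmx_mul !mulmxA. Qed.

Lemma congruence_sym m n (S : 'M[R]_n) (T : 'M[R]_(m, n)) : S^T = S ->
  (T *m S *m T^T)^T = T *m S *m T^T.
Proof. by move=> symS; rewrite !trmx_mul trmxK symS mulmxA. Qed.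

Lemma qform_diag n (d v : 'rV[R]_n) :
  qform (diag_mx d) v = \sum_i d 0 i * v 0 i ^+ 2.
Proof.
rewrite /qform mxE; apply: eq_bigr => i _; rewrite mul_mx_diag !mxE; ring.
Qed.

Lemma qform_row m n (S : 'M[R]_n) (T : 'M[R]_(m, n)) i :
  qform S (row i T) = (T *m S *m T^T) i i.
Proof.
by rewrite /qform -row_mul [LHS]mxE [RHS]mxE; apply: eq_bigr => j _; rewrite !mxE.
Qed.

Lemma qformD n (S T : 'M[R]_n) v : qform (S + T) v = qform S v + qform T v.
Proof. by rewrite /qform mulmxDr mulmxDl mxE. Qed.

Lemma qformN n (S : 'M[R]_n) v : qform (- S) v = - qform S v.
Proof. by rewrite /qform mulmxN mulNmx mxE. Qed.

Lemma qformZ n a (S : 'M[R]_n) v : qform (a *: S) v = a * qform S v.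
Proof. by rewrite /qform -scalemxAr -scalemxAl mxE. Qed.

Lemma fro2_gt0 n (v : 'rV[R]_n) : v != 0 -> 0 < fro2 v.
Proof.
move=> v0; rewrite lt_def fro2_ge0 andbT; apply: contraNneq v0.
rewrite /fro2 big_ord1 => /eqP; rewrite psumr_eq0 => [|i _]; last exact: sqr_ge0.
move=> /allP h; apply/eqP/rowP => j; rewrite mxE.
by have := h j; rewrite mem_index_enum => /(_ isT); rewrite sqrf_eq0 => /eqP.
Qed.

End quadratic_forms.

(** * The real spectral theorem *)

Section spectral_theorem.
Variable R : rcfType.

(** Over [R[i]] there is an eigenvalue [z], with row eigenvector [v]. If [w] is the conjugate
    transpose of [v], then [v S w] equals both [z (v w)] and [z^* (v w)], so [z] is real. *)
Lemma symmetric_eigenvalue n (S : 'M[R]_n.+1) : S^T = S ->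
  exists a, eigenvalue S a.
Proof.
move=> symS; pose f : {rmorphism R -> R[i]} := real_complex R.
have [z /eigenvalueP[v vS v0]] :=
  eigenvalue_closed (map_mx f S) (ltn0Sn n).
pose w := map_mx (Num.conj : R[i] -> R[i]) v^T.
have wS : map_mx f S *m w = z^* *: w.
  have -> : map_mx f S = map_mx (Num.conj : R[i] -> R[i]) (map_mx f S)^T.
    rewrite map_trmx symS -map_mx_comp; apply/matrixP => i j.
    by rewrite !mxE /=; apply/esym/conj_Creal/complex_realP; exists (S i j).
  by rewrite /w -map_mxM -trmx_mul vS linearZ /= map_mxZ.
have vw0 : (v *m w) 0 0 != 0.
  apply: contraNneq v0 => vw; apply/eqP/rowP => j; rewrite mxE.
  move: vw; rewrite mxE => /eqP.
  rewrite psumr_eq0 => [|i _]; last by rewrite !mxE mul_conjC_ge0.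
  by move=> /allP/(_ j); rewrite mem_index_enum => /(_ isT);
     rewrite !mxE /= mul_conjC_eq0 => /eqP.
have zE : z^* = z.
  have : z *: (v *m w) = z^* *: (v *m w).
    by rewrite scalemxAl -vS -mulmxA wS scalemxAr.
  by move=> /matrixP/(_ 0 0); rewrite [LHS]mxE [RHS]mxE => /(mulIf vw0).
have zR : z \is Num.real by apply/CrealP.
exists (complex.Re z); rewrite -(eigenvalue_map f); apply/eigenvalueP.
by exists v => //; rewrite vS /f /= RRe_real.
Qed.

(** The witness is the reflection that exchanges [u] and the first basis vector [e], that is
    [1 - 2 w^T w / |w|^2] with [w = u - e]. *)
Lemma orthogonal_first_row n (u : 'rV[R]_(1 + n)) : u *m u^T = 1%:M ->
  exists2 U : 'M[R]_(1 + n), U *m U^T = 1%:M & row 0 U = u.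
Proof.
move=> uu; pose e : 'rV[R]_(1 + n) := delta_mx 0 0; pose w := u - e.
have ee : e *m e^T = 1%:M.
  by rewrite trmx_delta mul_delta_mx; apply/matrixP => i j; rewrite !ord1 !mxE.
have ueT : e *m u^T = (u 0 0)%:M.
  by rewrite -rowE; apply/matrixP => i j; rewrite !ord1 !mxE mulr1n.
have euT : u *m e^T = (u 0 0)%:M.
  by rewrite -[u in LHS]trmxK -trmx_mul ueT tr_scalar_mx.
pose c : R := 2 - 2 * u 0 0.
have ww : w *m w^T = c%:M.
  rewrite /w linearB /= mulmxBr !mulmxBl uu ee ueT euT.
  by apply/matrixP => i j; rewrite !ord1 !mxE /= !mulr1n /c; ring.
have [c0|c0] := eqVneq c 0.
  exists 1%:M; first by rewrite trmx1 mulmx1.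
  suff -> : u = e by rewrite rowE mulmx1.
  apply/subr0_eq/rowP => j; rewrite -/w [RHS]mxE.
  have [->|/fro2_gt0] := eqVneq w 0; first by rewrite mxE.
  by rewrite fro2E ww c0 raddf0 mxtrace0 ltxx.
pose P := w^T *m w; pose b : R := 2 / c.
have PT : P^T = P by rewrite /P trmx_mul trmxK.
have PP : P *m P = c *: P.
  by rewrite /P mulmxA -(mulmxA w^T) ww mul_mx_scalar -scalemxAl.
exists (1%:M - b *: P).
  have -> : (1%:M - b *: P)^T = 1%:M - b *: P.
    by rewrite [LHS]linearB /= trmx1 linearZ /= PT.
  rewrite mulmxBr mulmx1 mulmxBl mul1mx -scalemxAl -scalemxAr PP !scalerA.
  have -> : b * b * c = b + b by rewrite /b; field.
  by rewrite scalerDl opprB addrK subrK.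
rewrite /b /P.
rewrite rowE mulmxBr mulmx1 -scalemxAr mulmxA -/e.
have -> : e *m w^T = (- (c / 2))%:M.
  rewrite /w linearB /= mulmxBr ueT ee.
  by apply/matrixP => i j; rewrite !ord1 !mxE /= !mulr1n /c; field.
rewrite mul_scalar_mx scalerA (_ : _ * _ = -1) ?scaleN1r; last by field.
by rewrite opprK addrC subrK.
Qed.

(** A unit eigenvector completed to an orthogonal matrix splits off a block of size 1, because
    the conjugated matrix is symmetric; induction diagonalises the other block. *)
Theorem symmetric_spectral n (S : 'M[R]_n) : S^T = S ->
  exists U (d : 'rV[R]_n), U *m U^T = 1%:M /\ S = U^T *m diag_mx d *m U.
Proof.
elim: n S => [|n IH] S symS.
  by exists 1%:M, 0; split; [rewrite trmx1 mulmx1|by apply/matrixP => -[]].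
have [a /eigenvalueP[v vS v0]] := symmetric_eigenvalue symS.
have vv := fro2_gt0 v0.
have vvE : (v *m v^T) 0 0 = fro2 v by rewrite fro2E /mxtrace big_ord1.
pose u : 'rV[R]_(1 + n) := (Num.sqrt (fro2 v))^-1 *: v.
have uu : u *m u^T = 1%:M.
  rewrite /u linearZ /= -scalemxAl -scalemxAr scalerA.
  apply/matrixP => i j; rewrite !ord1 [LHS]mxE vvE -expr2 exprVn.
  by rewrite sqr_sqrtr ?mulVf ?gt_eqF ?ltW// mxE.
have uS : u *m S = a *: u.
  by rewrite /u -scalemxAl vS !scalerA mulrC.
have [H HH Hu] := orthogonal_first_row uu.
have HH' : H^T *m H = 1%:M by apply: mulmx1C.
have [T defT] : exists T : 'M[R]_(1 + n), T = H *m S *m H^T by eexists.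
have symT : T^T = T by rewrite defT !trmx_mul trmxK symS mulmxA.
have T0 : row 0 T = a *: delta_mx 0 0.
  rewrite defT !row_mul Hu uS -scalemxAl -Hu -row_mul HH.
  by congr (_ *: _); rewrite rowE mulmx1.
have urT : ursubmx T = 0.
  apply/rowP => j; rewrite !mxE.
  have := congr1 (fun M : 'rV[R]_(1 + n) => M 0 (rshift 1 j)) T0.
  rewrite !mxE /= mulr0 => <-; congr (T _ _); exact/val_inj.
have ulT : ulsubmx T = a%:M.
  apply/matrixP => i j; rewrite !ord1 !mxE.
  have := congr1 (fun M : 'rV[R]_(1 + n) => M 0 0) T0.
  rewrite !mxE /= mulr1 mulr1n => <-; congr (T _ _); exact/val_inj.
have dlT : dlsubmx T = 0 by rewrite -[in LHS]symT -trmx_ursub urT trmx0.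
have [V [d [VV dT]]] : exists V (d : 'rV[R]_n),
    V *m V^T = 1%:M /\ drsubmx T = V^T *m diag_mx d *m V.
  by apply: IH; rewrite trmx_drsub symT.
pose W : 'M[R]_(1 + n) := block_mx 1%:M 0 0 V.
have WW : W *m W^T = 1%:M.
  rewrite /W tr_block_mx !trmx0 trmx1.
  rewrite mulmx_block !mulmx0 !mul0mx mulmx1 !addr0 add0r VV.
  by rewrite -scalar_mx_block.
pose D : 'rV[R]_(1 + n) := row_mx (a%:M : 'rV[R]_1) d.
have defD : T = W^T *m diag_mx D *m W.
  rewrite -(submxK T) ulT urT dlT dT diag_mx_row /W tr_block_mx !trmx0 trmx1.
  rewrite !mulmx_block !mulmx0 !mul0mx !mul1mx !mulmx1 !addr0 !add0r.
  congr block_mx; last by rewrite mul0mx.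
  by apply/matrixP => i j; rewrite !ord1 !mxE.
exists (W *m H), D; split.
  by rewrite trmx_mul mulmxA -(mulmxA W) HH mulmx1 WW.
have -> : S = H^T *m T *m H.
  by rewrite defT !mulmxA HH' mul1mx -mulmxA HH' mulmx1.
by rewrite defD trmx_mul !mulmxA.
Qed.

End spectral_theorem.

(** * Matrices with spectrum in an interval *)

Section loewner_interval.
Variable R : rcfType.

(** [S] is symmetric with [l I <= S <= u I] in the Loewner order. The form version is
    the one that passes to sums; [loewner_spectral] turns it into eigenvalue bounds. *)
Definition loewner l u n (S : 'M[R]_n) :=
  S^T = S /\ forall v, l * fro2 v <= qform S v <= u * fro2 v.

Lemma loewner_spectral l u n (S : 'M[R]_n) : loewner l u S ->
  exists (U : 'M[R]_n) (d : 'rV[R]_n),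
    [/\ U *m U^T = 1%:M, S = U^T *m diag_mx d *m U & forall i, l <= d 0 i <= u].
Proof.
move=> [symS bS]; have [U [d [UU SE]]] := symmetric_spectral symS.
exists U, d; split => // i; have := bS (row i U).
rewrite -qform_fro2 !qform_row mulmx1 UU SE !mulmxA UU mul1mx -mulmxA UU mulmx1.
by rewrite !mxE eqxx mulr1n !mulr1.
Qed.

Lemma spectral_loewner l u n (U : 'M[R]_n) (d : 'rV[R]_n) : U *m U^T = 1%:M ->
  (forall i, l <= d 0 i <= u) -> loewner l u (U^T *m diag_mx d *m U).
Proof.
move=> UU db; split=> [|v].
  by rewrite !trmx_mul trmxK tr_diag_mx mulmxA.
have := qform_conj (diag_mx d) U^T v; rewrite trmxK => ->; rewrite qform_diag.
have /fro2_orthogonal <- : U^T *m U^T^T = 1%:M by rewrite trmxK; exact: mulmx1C.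
rewrite /fro2 !big_ord1 !mulr_sumr.
by apply/andP; split; apply: ler_sum => i _; have /andP[] := db i;
  have := sqr_ge0 ((v *m U^T) 0 i); nra.
Qed.

(** The rows of the orthogonal factor of [S] are eigenvectors. *)
Lemma eigenvalue_loewner l u n (S : 'M[R]_n) : S^T = S ->
  (forall a, eigenvalue S a -> l <= a <= u) -> loewner l u S.
Proof.
move=> symS eS; have [U [d [UU SE]]] := symmetric_spectral symS.
rewrite SE; apply: spectral_loewner => // i; apply/eS/eigenvalueP.
exists (row i U).
  rewrite -row_mul SE !mulmxA UU mul1mx; apply/rowP => j.
  by rewrite mxE mul_diag_mx !mxE.
apply/eqP => U0; have /matrixP/(_ i i) := UU; rewrite [LHS]mxE mxE eqxx.
rewrite big1 => [/esym/eqP|j _]; first by rewrite oner_eq0.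
by have /rowP/(_ j) := U0; rewrite !mxE => ->; rewrite mul0r.
Qed.

Section positive.
Variables (l u : R) (n : nat) (S : 'M[R]_n).
Hypotheses (l0 : 0 < l) (Sb : loewner l u S).

Lemma loewner_det_gt0 : 0 < \det S.
Proof.
have [U [d [UU -> db]]] := loewner_spectral Sb.
rewrite !det_mulmx mulrAC -det_mulmx (mulmx1C UU) det1 mul1r det_diag.
by apply: prodr_gt0 => i _; have /andP[+ _] := db i; apply: lt_le_trans.
Qed.

Lemma loewner_unit : S \in unitmx.
Proof. by rewrite unitmxE unitfE gt_eqF// loewner_det_gt0. Qed.

Lemma loewner_inv : loewner u^-1 l^-1 (invmx S).
Proof.
have [U [d [UU SE db]]] := loewner_spectral Sb.
have d0 i : 0 < d 0 i by have /andP[+ _] := db i; apply: lt_le_trans.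
pose e : 'rV[R]_n := \row_i (d 0 i)^-1.
have -> : invmx S = U^T *m diag_mx e *m U.
  suff SX : S *m (U^T *m diag_mx e *m U) = 1%:M.
    by rewrite -[RHS](mulKmx loewner_unit) SX mulmx1.
  rewrite SE !mulmxA -(mulmxA _ U) UU mulmx1 -(mulmxA U^T) mulmx_diag.
  rewrite (_ : diag_mx _ = 1%:M) ?mulmx1 ?(mulmx1C UU)//.
  by rewrite -diag_const_mx; congr diag_mx; apply/rowP => i;
    rewrite !mxE divff// gt_eqF.
apply: spectral_loewner => // i; have /andP[ld du] := db i.
by rewrite mxE !lef_pV2// ?du ?ld// posrE (lt_le_trans (d0 i)).
Qed.

Lemma loewner_mulmx m (M : 'M[R]_(m, n)) : fro2 (M *m S) <= u ^+ 2 * fro2 M.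
Proof.
have [U [d [UU -> db]]] := loewner_spectral Sb.
rewrite mulmxA fro2_orthogonal// mulmxA.
have UU' : U^T *m U^T^T = 1%:M by rewrite trmxK; exact: mulmx1C.
rewrite -(fro2_orthogonal M UU'); move: (M *m U^T) => B.
rewrite /fro2 mulr_sumr; apply: ler_sum => i _; rewrite mulr_sumr.
apply: ler_sum => j _; rewrite mul_mx_diag mxE exprMn mulrC.
rewrite ler_wpM2r ?sqr_ge0//.
by have /andP[ld du] := db j; rewrite ler_sqr ?nnegrE//; apply: ltW;
  [apply: lt_le_trans ld|apply: lt_le_trans (le_trans ld du)].
Qed.

End positive.

Lemma loewner_mulmxl l u m n (S : 'M[R]_n) (M : 'M[R]_(n, m)) : 0 < l ->
  loewner l u S -> fro2 (S *m M) <= u ^+ 2 * fro2 M.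
Proof.
move=> l0 Sb; have := loewner_mulmx l0 Sb M^T.
by rewrite -{1}Sb.1 -trmx_mul !fro2_tr.
Qed.

Lemma loewnerW l u l' u' n (S : 'M[R]_n) : l' <= l -> u <= u' ->
  loewner l u S -> loewner l' u' S.
Proof.
move=> ll uu [symS bS]; split=> // v; have /andP[b1 b2] := bS v.
by have f0 := fro2_ge0 v; apply/andP; split; nra.
Qed.

(** Simultaneous diagonalisation. If [A = U^T diag d U] and [T = diag (d ^ (-1/2)) U], then
    [T A T^T = 1], and [mu] is the spectrum of [T M T^T]. The trace and the determinant depend
    on [mu] alone; the map [v |-> v T] multiplies squared lengths by a factor between [1 / b]
    and [1 / a], which bounds [mu] and compares the Frobenius norms. *)
Lemma relative_spectrum a b n (A M : 'M[R]_n) : 0 < a -> a <= b ->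
  loewner a b A -> loewner a b M ->
  exists mu : 'rV[R]_n,
  [/\ forall i, a / b <= mu 0 i <= b / a,
      \det M = \det A * \prod_i mu 0 i,
      \tr (invmx A *m (M - A)) = \sum_i (mu 0 i - 1),
      fro2 (M - A) / b ^+ 2 <= \sum_i (mu 0 i - 1) ^+ 2 &
      \sum_i (mu 0 i - 1) ^+ 2 <= fro2 (M - A) / a ^+ 2].
Proof.
move=> a0 ab Ab Mb; have b0 : 0 < b by apply: lt_le_trans ab.
have [U [d [UU AE db]]] := loewner_spectral Ab.
have d0 i : 0 < d 0 i by have /andP[+ _] := db i; apply: lt_le_trans.
pose s : 'rV[R]_n := \row_i (Num.sqrt (d 0 i))^-1.
have s2 i : s 0 i ^+ 2 = (d 0 i)^-1 by rewrite mxE exprVn sqr_sqrtr ?ltW.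
pose T := diag_mx s *m U.
have TT : T^T = U^T *m diag_mx s by rewrite trmx_mul tr_diag_mx.
have TA : T *m A *m T^T = 1%:M.
  rewrite TT AE /T !mulmxA -(mulmxA _ U) UU mulmx1 -(mulmxA _ U) UU mulmx1.
  rewrite !mulmx_diag -diag_const_mx; congr diag_mx; apply/rowP => i.
  by rewrite [LHS]mxE [in LHS]mxE mulrAC -expr2 s2 mxE mulVf// gt_eqF.
have invA : invmx A = T^T *m T.
  have A1 : A *m (T^T *m T) = 1%:M.
    by rewrite mulmxA; apply: mulmx1C; rewrite mulmxA.
  by rewrite -[RHS](mulKmx (loewner_unit a0 Ab)) A1 mulmx1.
have M'b : loewner (a / b) (b / a) (T *m M *m T^T).
  split=> [|v]; first exact: congruence_sym Mb.1.
  rewrite qform_conj; have /andP[m1 m2] := Mb.2 (v *m T).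
  have : fro2 (v *m T) = \sum_i v 0 i ^+ 2 / d 0 i.
    rewrite /T mulmxA fro2_orthogonal// /fro2 big_ord1; apply: eq_bigr => i _.
    by rewrite mul_mx_diag mxE exprMn s2.
  have f1 : fro2 v / b <= \sum_i v 0 i ^+ 2 / d 0 i.
    rewrite /fro2 big_ord1 mulr_suml; apply: ler_sum => i _.
    by rewrite ler_wpM2l ?sqr_ge0// lef_pV2 ?posrE//; case/andP: (db i).
  have f2 : \sum_i v 0 i ^+ 2 / d 0 i <= fro2 v / a.
    rewrite /fro2 big_ord1 mulr_suml; apply: ler_sum => i _.
    by rewrite ler_wpM2l ?sqr_ge0// lef_pV2 ?posrE//; case/andP: (db i).
  move=> fE; rewrite -!fE in f1 f2; apply/andP; split.
    by apply: le_trans m1; rewrite -mulrA (ler_wpM2l (ltW a0))// mulrC.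
  by apply: (le_trans m2); rewrite -mulrA (ler_wpM2l (ltW b0))// mulrC.
have [V [mu [VV ME mub]]] := loewner_spectral M'b.
have VM1 : T *m (M - A) *m T^T = V^T *m diag_mx (mu - const_mx 1) *m V.
  rewrite mulmxBr mulmxBl TA ME linearB /= diag_const_mx mulmxBr mulmxBl mulmx1.
  by rewrite (mulmx1C VV).
pose E := U *m (M - A) *m U^T.
have fE : fro2 E = fro2 (M - A).
  have UU' : U^T *m U^T^T = 1%:M by rewrite trmxK; exact: mulmx1C.
  by rewrite /E fro2_orthogonal// -fro2_tr trmx_mul fro2_orthogonal// fro2_tr.
have sumE : \sum_i (mu 0 i - 1) ^+ 2 =
    \sum_i \sum_j E i j ^+ 2 / (d 0 i * d 0 j).
  transitivity (fro2 (T *m (M - A) *m T^T)).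
    rewrite VM1 fro2_orthogonal// -fro2_tr trmx_mul trmxK fro2_orthogonal//.
    rewrite tr_diag_mx /fro2; apply: eq_bigr => i _.
    rewrite (bigD1 i)//= big1 => [|j ji]; rewrite !mxE.
      by rewrite eqxx mulr1n addr0.
    by rewrite eq_sym (negPf ji) mulr0n expr0n.
  have -> : T *m (M - A) *m T^T = diag_mx s *m E *m diag_mx s.
    by rewrite TT /T /E !mulmxA.
  apply: eq_bigr => i _; apply: eq_bigr => j _.
  by rewrite mul_mx_diag mxE mul_diag_mx mxE !exprMn !s2 invfM; ring.
exists mu; split => //.
- have e1 : \det T * \det A * \det T = 1.
    by rewrite -{2}[T]trmxK det_tr -!det_mulmx TA det1.
  have e2 : \det T * \det M * \det T = \prod_i mu 0 i.
    rewrite -{2}[T]trmxK det_tr -!det_mulmx ME !det_mulmx mulrAC -det_mulmx.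
    by rewrite (mulmx1C VV) det1 mul1r det_diag.
  by rewrite -e2 -[LHS]mul1r -e1; ring.
- rewrite invA -mulmxA mxtrace_mulC VM1 -mulmxA mxtrace_mulC.
  rewrite -mulmxA VV mulmx1 mxtrace_diag; apply: eq_bigr => i _.
  by rewrite !mxE.
- rewrite sumE -fE /fro2 mulr_suml; apply: ler_sum => i _.
  rewrite mulr_suml; apply: ler_sum => j _.
  have /andP[_ di] := db i; have /andP[_ dj] := db j.
  rewrite ler_wpM2l ?sqr_ge0// lef_pV2 ?posrE ?mulr_gt0 ?exprn_gt0//.
  by rewrite expr2 ler_pM// ltW.
- rewrite sumE -fE /fro2 mulr_suml; apply: ler_sum => i _.
  rewrite mulr_suml; apply: ler_sum => j _.
  have /andP[di _] := db i; have /andP[dj _] := db j.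
  rewrite ler_wpM2l ?sqr_ge0// lef_pV2 ?posrE ?mulr_gt0 ?exprn_gt0//.
  by rewrite expr2 ler_pM// ltW.
Qed.

End loewner_interval.

(** * Second-order bounds for the log-determinant *)

Section log_determinant.
Variable R : realType.

(** At [y = sqrt x], [ln x = 2 ln y <= 2 (y - 1)], which is below the tangent [x - 1] by
    [(y - 1)^2 = (x - 1)^2 / (y + 1)^2], and [(y + 1)^2 <= 2 (x + 1)]. *)
Lemma ln_le_quadratic (b x : R) : 0 < x -> x <= b ->
  ln x <= (x - 1) - (x - 1) ^+ 2 / (2 * (b + 1)).
Proof.
move=> x0 xb; pose y := Num.sqrt x; have y0 : 0 < y by rewrite sqrtr_gt0.
have xE : x = y ^+ 2 by rewrite sqr_sqrtr// ltW.
have lny : ln y <= y - 1.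
  by have := @le_ln1Dx _ (y - 1); rewrite addrCA subrr addr0; apply; lra.
have -> : ln x = 2 * ln y by rewrite xE lnXn// mulr_natl.
apply: (@le_trans _ _ (2 * (y - 1))); first by rewrite ler_pM2l.
rewrite lerBrDl -lerBrDr ler_pdivrMr; last by lra.
rewrite xE in xb *.
have -> : (y ^+ 2 - 1) ^+ 2 = (y - 1) ^+ 2 * (y + 1) ^+ 2 by ring.
have -> : y ^+ 2 - 1 - 2 * (y - 1) = (y - 1) ^+ 2 by ring.
by rewrite ler_wpM2l ?sqr_ge0//; have := sqr_ge0 (y - 1); lra.
Qed.

(** The tangent inequality at [x^-1] reads
    [ln x >= 1 - x^-1 = (x - 1) - (x - 1)^2 / x]. *)
Lemma quadratic_le_ln (m x : R) : 0 < m -> m <= x ->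
  (x - 1) - (x - 1) ^+ 2 / m <= ln x.
Proof.
move=> m0 mx; have x0 : 0 < x by apply: lt_le_trans mx.
have lnx : ln x^-1 <= x^-1 - 1.
  have := @le_ln1Dx _ (x^-1 - 1); rewrite addrCA subrr addr0; apply.
  by rewrite ltrBrDl subrr invr_gt0.
rewrite -[x in ln x]invrK lnV ?posrE ?invr_gt0//.
apply: (@le_trans _ _ (1 - x^-1)); last by lra.
apply: (@le_trans _ _ ((x - 1) - (x - 1) ^+ 2 / x)).
  by rewrite lerD2l lerN2 ler_wpM2l ?sqr_ge0// lef_pV2.
rewrite le_eqVlt; apply/orP; left; apply/eqP; field; exact: lt0r_neq0.
Qed.

Lemma ln_prod n (mu : 'rV[R]_n) : (forall i, 0 < mu 0 i) ->
  ln (\prod_i mu 0 i) = \sum_i ln (mu 0 i).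
Proof.
move=> mu0; pose Q (p s : R) := 0 < p /\ ln p = s.
suff [] : Q (\prod_i mu 0 i) (\sum_i ln (mu 0 i)) by [].
apply: (big_ind2 Q) => [|p s q t [p0 <-] [q0 <-]|i _]; first by split; rewrite ?ln1.
  by split; [rewrite mulr_gt0|rewrite lnM].
by split.
Qed.

Section two_sided.
Variables (a b : R) (n : nat) (A M : 'M[R]_n).
Hypotheses (a0 : 0 < a) (ab : a <= b).
Hypotheses (Ab : loewner a b A) (Mb : loewner a b M).

(** Strong concavity of [ln det]: the scalar bound at every eigenvalue of [M] relative to
    [A]. *)
Lemma logdet_le : ln (\det M) - ln (\det A) <=
  \tr (invmx A *m (M - A)) - fro2 (M - A) / (b ^+ 2 * (2 * (b / a + 1))).
Proof.
have [mu [mub -> -> lb _]] := relative_spectrum a0 ab Ab Mb.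
have b0 : 0 < b by apply: lt_le_trans ab.
have r0 : 0 < a / b by rewrite divr_gt0.
have mu0 i : 0 < mu 0 i by case/andP: (mub i) => + _; exact: lt_le_trans.
have dA := loewner_det_gt0 a0 Ab.
rewrite lnM ?posrE ?prodr_gt0// addrAC subrr add0r ln_prod//.
have c0 : 0 < 2 * (b / a + 1) by rewrite mulr_gt0// addr_gt0// divr_gt0.
apply: (@le_trans _ _ (\sum_i ((mu 0 i - 1)
    - (mu 0 i - 1) ^+ 2 / (2 * (b / a + 1))))).
  by apply: ler_sum => i _; apply: ln_le_quadratic; case/andP: (mub i).
rewrite [leLHS]big_split /= lerD2l sumrN lerN2 -mulr_suml invfM mulrA.
by rewrite ler_wpM2r// invr_ge0 ltW.
Qed.

(** Smoothness of [ln det], by the opposite scalar bound. *)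
Lemma logdet_ge : \tr (invmx A *m (M - A)) - fro2 (M - A) * (b / a ^+ 3) <=
  ln (\det M) - ln (\det A).
Proof.
have [mu [mub -> -> _ ub]] := relative_spectrum a0 ab Ab Mb.
have b0 : 0 < b by apply: lt_le_trans ab.
have r0 : 0 < a / b by rewrite divr_gt0.
have mu0 i : 0 < mu 0 i by case/andP: (mub i) => + _; exact: lt_le_trans.
have dA := loewner_det_gt0 a0 Ab.
rewrite lnM ?posrE ?prodr_gt0// [leRHS]addrAC subrr add0r ln_prod//.
apply: (@le_trans _ _ (\sum_i ((mu 0 i - 1) - (mu 0 i - 1) ^+ 2 / (a / b)))).
  rewrite [leRHS]big_split /= lerD2l sumrN lerN2 -mulr_suml.
  have -> : b / a ^+ 3 = (a ^+ 2)^-1 * (a / b)^-1.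
    by field; rewrite !gt_eqF.
  by rewrite mulrA ler_wpM2r// invr_ge0 ltW.
by apply: ler_sum => i _; apply: quadratic_le_ln => //; case/andP: (mub i).
Qed.

End two_sided.

(** Write [A], [A1], [A0] for the inverses of [S], [S1], [S0]. The left-hand side combines the
    increments of [ln det] from [A0] to [A], bounded by strong concavity, and to [A1] and [Q],
    bounded by smoothness. As [Q - A0 = al (A - A0) - al (A1 - A0)], the tangent terms cancel.
    If [D] and [E] are the squared distances of [A] and [A1] to [A0], what remains is at most
    [- al c D + al C E + 2 al^2 C (D + E)], where the last term is of higher order in [al].
    Distances between inverses are comparable to distances between matrices. *)
Lemma fractional_logdet (L : R) : 1 < L -> exists al k1 k2 : R,
  [/\ 0 < al < 1, 0 < k1, 0 < k2 & forall n (S0 S S1 : 'M[R]_n),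
    loewner L^-1 L S0 -> loewner 1 (1 + L) S -> loewner 1 (1 + L) S1 ->
    let Q := invmx S0 + al *: (invmx S - invmx S1) in
    loewner (2 * (1 + L))^-1 (1 + L) Q /\
    al * (ln (\det (invmx S)) - ln (\det (invmx S1)))
      + ln (\det (invmx S0)) - ln (\det Q)
    <= al * (k2 * fro2 (S1 - S0) - k1 * fro2 (S - S0))].
Proof.
move=> L1; have L0 : 0 < L by apply: lt_trans L1.
pose b := 1 + L; pose a := (2 * b)^-1.
have b0 : 0 < b by rewrite /b; lra.
have a0 : 0 < a by rewrite invr_gt0 mulr_gt0.
have ab : a <= b.
  by rewrite /a invf_ple ?posrE ?mulr_gt0// (@le_trans _ _ 1)// ?invf_le1 /b; lra.
pose c := (b ^+ 2 * (2 * (b / a + 1)))^-1; pose C := b / a ^+ 3.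
have c0 : 0 < c.
  by rewrite invr_gt0 mulr_gt0 ?exprn_gt0// mulr_gt0// addr_gt0// divr_gt0.
have C0 : 0 < C by rewrite divr_gt0// exprn_gt0.
(* the first bound keeps [Q] positive definite, by the second the concavity gain absorbs
   the term in [al ^+ 2] *)
pose al := Num.min (2 * L)^-1 (c / (4 * C)).
have al0 : 0 < al.
  by rewrite lt_min invr_gt0 mulr_gt0//= divr_gt0// mulr_gt0.
have al1 : al <= (2 * L)^-1 by rewrite ge_min lexx.
have al2 : 4 * C * al <= c.
  have : al <= c / (4 * C) by rewrite ge_min lexx orbT.
  by rewrite ler_pdivlMr; lra.
have alL : al * L <= 2^-1.
  by rewrite -ler_pdivlMr// (le_trans al1)// invfM.
have alh : al < 1 by nra.
pose k1 := c / 2 / ((1 + L) ^+ 2 * L ^+ 2); pose k2 := (C + c / 2) * L ^+ 2.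
exists al, k1, k2; split; first by rewrite al0.
- by rewrite divr_gt0 ?mulr_gt0 ?exprn_gt0// ?invr_gt0.
- by rewrite mulr_gt0 ?exprn_gt0// addr_gt0// divr_gt0.
move=> n S0 S S1 S0b Sb S1b Q.
have Li0 : 0 < L^-1 by rewrite invr_gt0.
have A0b := loewner_inv Li0 S0b; have Ab := loewner_inv ltr01 Sb.
have A1b := loewner_inv ltr01 S1b.
rewrite invrK in A0b; rewrite invr1 in Ab A1b.
set A0 := invmx S0 in A0b Q *; set A := invmx S in Ab Q *.
set A1 := invmx S1 in A1b Q *.
have aL : a <= L^-1 by rewrite /a /b lef_pV2 ?posrE; nra.
have ai : a <= (1 + L)^-1 by rewrite /a /b lef_pV2 ?posrE; nra.
have bi0 : 0 < (1 + L)^-1 by rewrite invr_gt0.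
have Qb : loewner a b Q.
  split=> [|v].
    by rewrite /Q linearD linearZ linearB /= A0b.1 Ab.1 A1b.1.
  rewrite /Q qformD qformZ qformD qformN.
  have := A0b.2 v; have := Ab.2 v; have := A1b.2 v; have := fro2_ge0 v.
  move: (qform A0 v) (qform A v) (qform A1 v) (fro2 v) => q0 q q1 f.
  move=> f0 /andP[u1 u2] /andP[u3 u4] /andP[u5 u6].
  have w1 : 0 <= (1 + L)^-1 * f by rewrite mulr_ge0 // ltW.
  have w2 : L^-1 * f = 2 * ((2 * L)^-1 * f) by field; rewrite gt_eqF.
  have w3 : a * f <= (2 * L)^-1 * f.
    by rewrite ler_wpM2r// /a /b lef_pV2 ?posrE; nra.
  have w4 : al * f <= (2 * L)^-1 * f by rewrite ler_wpM2r.
  have w5 : al * (- f) <= al * (q - q1) by rewrite ler_pM2l//; lra.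
  have w6 : al * (q - q1) <= al * f by rewrite ler_pM2l//; lra.
  have w7 : al * f <= f by rewrite -[leRHS]mul1r ler_wpM2r// ltW.
  rewrite mulrN in w5; apply/andP; split; first by lra.
  by rewrite /b; lra.
split => //.
have Lb : L <= b by rewrite /b; lra.
have b1 : 1 <= b by rewrite /b; lra.
have A0w := loewnerW aL Lb A0b; have Aw := loewnerW ai b1 Ab.
have A1w := loewnerW ai b1 A1b.
have e1 := logdet_le a0 ab A0w Aw.
have e2 := logdet_ge a0 ab A0w A1w.
have e3 := logdet_ge a0 ab A0w Qb.
have QA : Q - A0 = al *: ((A - A0) - (A1 - A0)).
  by rewrite /Q addrAC subrr add0r opprB addrA subrK.
have dQ : fro2 (Q - A0) <= al ^+ 2 * (2 * fro2 (A - A0) + 2 * fro2 (A1 - A0)).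
  rewrite QA; have -> (X : 'M[R]_n) : fro2 (al *: X) = al ^+ 2 * fro2 X.
    rewrite /fro2 mulr_sumr; apply: eq_bigr => i _; rewrite mulr_sumr.
    by apply: eq_bigr => j _; rewrite mxE exprMn.
  rewrite ler_wpM2l ?sqr_ge0//; have := fro2D (A - A0) (- (A1 - A0)).
  by rewrite fro2N.
have tQ : \tr (invmx A0 *m (Q - A0)) =
    al * (\tr (invmx A0 *m (A - A0)) - \tr (invmx A0 *m (A1 - A0))).
  by rewrite QA -scalemxAr mxtraceZ mulmxBr linearB.
have uS := loewner_unit ltr01 Sb; have uS1 := loewner_unit ltr01 S1b.
have uS0 := loewner_unit Li0 S0b.
have dS : k1 * fro2 (S - S0) <= c / 2 * fro2 (A - A0).
  have -> : S - S0 = - (S *m (A - A0) *m S0).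
    rewrite mulmxBr mulmxBl mulmxV// mul1mx -mulmxA mulVmx// mulmx1.
    by rewrite opprB.
  have h : fro2 (S *m (A - A0) *m S0) <=
      (1 + L) ^+ 2 * L ^+ 2 * fro2 (A - A0).
    apply: (le_trans (loewner_mulmx Li0 S0b _)).
    have := ler_wpM2l (sqr_ge0 L) (loewner_mulmxl (A - A0) ltr01 Sb).
    by rewrite mulrCA mulrA.
  have K0 : 0 < (1 + L) ^+ 2 * L ^+ 2 by rewrite mulr_gt0 ?exprn_gt0.
  rewrite fro2N /k1 -mulrA ler_wpM2l ?divr_ge0 ?(ltW c0)//.
  by rewrite mulrC ler_pdivrMr// mulrC.
have dS1 : fro2 (A1 - A0) <= L ^+ 2 * fro2 (S1 - S0).
  have -> : A1 - A0 = - (A1 *m (S1 - S0) *m A0).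
    rewrite mulmxBr mulmxBl mulVmx// mul1mx -mulmxA mulmxV// mulmx1.
    by rewrite opprB.
  rewrite fro2N (le_trans (loewner_mulmx _ A0b _)) ?invr_gt0//.
  rewrite ler_wpM2l ?sqr_ge0// (le_trans (loewner_mulmxl _ bi0 A1b))//.
  by rewrite expr1n mul1r.
rewrite tQ in e3; move: e1 e2 e3 dQ dS dS1; rewrite -/c -/C /k2.
move: (ln (\det A)) (ln (\det A0)) (ln (\det A1)) (ln (\det Q)) => lA lA0 lA1 lQ.
move: (\tr _) (\tr _) => tD tE.
move: (fro2_ge0 (A - A0)) (fro2_ge0 (A1 - A0)).
move: (fro2 (A - A0)) (fro2 (A1 - A0)) (fro2 (Q - A0)) => D E FQ.
move: (fro2 (S - S0)) (fro2 (S1 - S0)) => F F1 D0 E0 e1 e2 e3 dQ dS dS1.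
have g1 := ler_wpM2l (ltW al0) e1; have g2 := ler_wpM2l (ltW al0) e2.
have g3 := ler_wpM2l (ltW C0) dQ.
have g4 := ler_wpM2l (ltW al0) dS.
have h2 : (C + c / 2) * E <= (C + c / 2) * (L ^+ 2 * F1).
  by apply: ler_wpM2l dS1; lra.
have g5 := ler_wpM2l (ltW al0) h2.
have h3 : 4 * C * al * (al * (D + E)) <= c * (al * (D + E)).
  by rewrite ler_wpM2r// mulr_ge0 ?addr_ge0// ltW.
lra.
Qed.

End log_determinant.

(** * Change of measure for nonnegative integrands *)

Section transfer.
Local Open Scope ereal_scope.
Context d1 d2 (T : measurableType d1) (U : measurableType d2) (R : realType).
Variables (mu : {measure set T -> \bar R}) (nu : {measure set U -> \bar R}).
Variables (f : T -> U) (h : T -> R) (c : R).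
Hypotheses (mf : measurable_fun setT f) (mh : measurable_fun setT h).
Hypothesis h0 : forall t, (0 <= h t)%R.
Hypothesis H : forall A, measurable A ->
  \int[mu]_t ((h t)%:E * (\1_A (f t))%:E) = c%:E * nu A.

Import HBNNSimple.

Let transfer_nnsfun (k : {nnsfun U >-> R}) :
  \int[mu]_t ((h t)%:E * (k (f t))%:E) = c%:E * \int[nu]_u (k u)%:E.
Proof.
transitivity (\sum_(y \in range k) (y%:E *
    \int[mu]_t ((h t)%:E * (\1_(k @^-1` [set y]) (f t))%:E))).
  under eq_integral => t _.
    rewrite fimfunE -fsumEFin// ge0_mule_fsumr; last first.
      by move=> y; rewrite EFinM nnfun_muleindic_ge0.
    over.
  rewrite ge0_integral_fsum//; last 2 first.
  - move=> y; apply: emeasurable_funM; first exact/measurable_EFinP.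
    apply/measurable_EFinP/measurable_funM => //.
    exact: measurableT_comp.
  - by move=> y t _; rewrite mule_ge0 ?lee_fin// -lee_fin EFinM nnfun_muleindic_ge0.
  apply: eq_fsbigr => y; rewrite inE => -[u _ <-].
  rewrite -ge0_integralZl//; last 3 first.
  - apply: emeasurable_funM; first exact/measurable_EFinP.
    by apply/measurable_EFinP/measurableT_comp.
  - by move=> t _; rewrite mule_ge0// lee_fin.
  - by rewrite lee_fin.
  by apply: eq_integral => t _; rewrite EFinM muleCA.
rewrite integralT_nnsfun sintegralE ge0_mule_fsumr; last first.
  by move=> y; exact: nnsfun_mulemu_ge0.
by apply: eq_fsbigr => y _; rewrite H// muleCA.
Qed.

(** Both sides are linear in [g] and continuous along increasing sequences, so the case of
    indicators extends to all [g] through simple functions. With [f] the identity this is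
    integration against a density; with [h] independent of [f] it factors an expectation. *)
Lemma ge0_integral_transfer (g : U -> \bar R) : measurable_fun setT g ->
  (forall u, 0 <= g u) ->
  \int[mu]_t ((h t)%:E * g (f t)) = c%:E * \int[nu]_u g u.
Proof.
move=> mg g0; pose k := nnsfun_approx measurableT mg.
have kg u : EFin \o k^~ u @ \oo --> g u by apply: cvg_nnsfun_approx.
have mk n : measurable_fun setT (EFin \o k n).
  exact/measurable_EFinP.
have -> : \int[nu]_u g u = limn (fun n => \int[nu]_u (k n u)%:E).
  rewrite -monotone_convergence//.
  - by apply: eq_integral => u _; apply/esym/cvg_lim => //; exact: kg.
  - by move=> n u _; rewrite lee_fin.
  - by move=> u _ m n mn; rewrite lee_fin; exact/lefP/nd_nnsfun_approx.
have cvgk : cvgn (fun n => \int[nu]_u (k n u)%:E).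
  apply: ereal_nondecreasing_is_cvgn => a b ab; apply: ge0_le_integral => //.
  - by move=> u _; rewrite lee_fin.
  - exact: mk.
  - exact: mk.
  - by move=> u _; rewrite lee_fin; exact/lefP/nd_nnsfun_approx.
transitivity (limn (fun n => c%:E * \int[nu]_u (k n u)%:E)); last exact: limeMl.
have -> : (fun n => c%:E * \int[nu]_u (k n u)%:E) =
    (fun n => \int[mu]_t ((h t)%:E * (k n (f t))%:E)).
  by apply/funext => n; rewrite transfer_nnsfun.
rewrite -monotone_convergence//.
- apply: eq_integral => t _; apply/esym/cvg_lim => //; apply: cvgeZl => //.
  exact: kg.
- move=> n; apply: emeasurable_funM; first exact/measurable_EFinP.
  apply/measurable_EFinP; apply: measurableT_comp => //.
- by move=> n t _; rewrite mule_ge0// lee_fin.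
- move=> t _ m n mn; rewrite lee_wpmul2l ?lee_fin//.
  exact/lefP/nd_nnsfun_approx.
Qed.

End transfer.

(** * Products over an independent sample *)

Section independence.
Context d (W : measurableType d) (R : realType) (P : probability W R).
Variables (p n : nat) (X : 'I_n -> {RV P >-> Rvec R p}).
Variables (g : Rvec R p -> R) (e : R).
Hypotheses (indX : mutually_independent X) (mg : measurable_fun setT g).
Hypotheses (g0 : forall x, 0 <= g x).
Hypothesis Eg : forall i, (\int[P]_w (g (X i w))%:E = e%:E)%E.

Let phi m (A : 'I_n -> set (Rvec R p)) (i : 'I_n) (x : Rvec R p) : R :=
  if (i < m)%N then g x else \1_(A i) x.

Let q m (A : 'I_n -> set (Rvec R p)) (i : 'I_n) : R :=
  if (i < m)%N then e else fine (P (X i @^-1` A i)).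

Let phi0 m A i x : 0 <= phi m A i x.
Proof. by rewrite /phi; case: ifP. Qed.

Let mphi m A i : (forall i, measurable (A i)) -> measurable_fun setT (phi m A i).
Proof.
by move=> mA; rewrite /phi; case: (i < m)%N => //; exact: measurable_indic.
Qed.

Let mX i : measurable_fun setT (X i).
Proof. exact: measurable_funPT. Qed.

(** The indicators are traded for [g] one factor at a time. With the product [h] of the other
    factors fixed, the previous stage for every set in the place [m] says that
    [B |-> E (h 1_B (X_m))] is a multiple of the law of [X_m]. *)
Let expectation_prod_phi m A : (m <= n)%N -> (forall i, measurable (A i)) ->
  (\int[P]_w (\prod_i phi m A i (X i w))%:E = (\prod_i q m A i)%:E)%E.
Proof.
elim: m A => [|m IH] A mn mA.
  have mXA i : measurable (X i @^-1` A i).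
    by rewrite -[X in measurable X]setTI; exact: mX.
  have -> : (\prod_i q 0 A i)%:E = P (\bigcap_(i in [set: 'I_n]) (X i @^-1` A i)).
    rewrite indX// (big_morph EFin EFinM erefl); apply: eq_bigr => i _.
    by rewrite /q ltn0 fineK// fin_num_measure.
  rewrite -[X in P X]setIT -integral_indic//; last first.
    by apply: fin_bigcap_measurable; first exact: finite_finset.
  apply: eq_integral => w _; congr (_%:E).
  rewrite indicE; set B := \bigcap_(i in _) _; have [Aw|nAw] := pselect (B w).
    rewrite mem_set//; apply: big1 => i _; rewrite /phi ltn0 indicE mem_set//; exact: Aw.
  have [i nA] : exists i, ~ A i (X i w).
    apply: contrapT => /forallNP h; apply: nAw => i _; exact: contrapT (h i).
  by rewrite memNset// (bigD1 i)//= /phi ltn0 indicE memNset// mul0r.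
pose j := Ordinal mn.
pose h w := \prod_(i | i != j) phi m A i (X i w).
pose c := \prod_(i | i != j) q m A i.
have nj i : i != j -> (i < m.+1)%N = (i < m)%N.
  move=> ij; rewrite ltnS leq_eqVlt (_ : (i == m :> nat) = false)//.
  exact: negbTE ij.
have -> : (\prod_i q m.+1 A i)%:E = (c%:E * e%:E)%E.
  rewrite (bigD1 j)//= /q ltnSn mulrC EFinM; congr (_%:E * _)%E.
  by apply: eq_bigr => i /nj ->.
transitivity (\int[P]_w ((h w)%:E * (g (X j w))%:E))%E.
  apply: eq_integral => w _; rewrite -EFinM; congr (_%:E).
  rewrite (bigD1 j)//= /phi ltnSn mulrC; congr (_ * _).
  by apply: eq_bigr => i /nj ->.
have mh : measurable_fun setT h.
  have -> : h = fun w => \prod_i (if i != j then phi m A i (X i w) else 1).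
    by apply/funext => w; rewrite /h big_mkcond.
  apply: measurable_prod => i _; case: (i != j); last exact: measurable_cst.
  by apply: measurableT_comp => //; exact: mphi.
have tr := @ge0_integral_transfer _ _ _ _ _ P (distribution P (X j)) (X j) h c.
rewrite (tr (mX j) mh _ _ (EFin \o g)) {tr}//.
- rewrite ge0_integral_distribution//; first by rewrite -(Eg j).
  exact/measurable_EFinP.
- by move=> t; apply: prodr_ge0 => i _.
- move=> B mB; pose A' i := if i == j then B else A i.
  have := IH A' (ltnW mn).
  have -> : (\prod_i q m A' i)%:E = (c%:E * distribution P (X j) B)%E.
    rewrite (bigD1 j)//= {1}/q ltnn /A' eqxx mulrC EFinM fineK; last first.
      by rewrite fin_num_measure// -[X in measurable X]setTI; exact: mX.
    congr (_%:E * _)%E; apply: eq_bigr => i ij.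
    by rewrite /q (negPf ij).
  move=> <-; last by move=> i; rewrite /A'; case: ifP.
  apply: eq_integral => w _; rewrite -EFinM; congr (_%:E).
  rewrite [RHS](bigD1 j)//= {1}/phi ltnn /A' eqxx mulrC; congr (_ * _).
  by apply: eq_bigr => i ij; rewrite /phi (negPf ij).
- exact/measurable_EFinP.
Qed.

Lemma expectation_prod_iid :
  (\int[P]_w (\prod_i g (X i w))%:E = (e ^+ n)%:E)%E.
Proof.
have := @expectation_prod_phi n (fun=> setT) (leqnn n) (fun=> measurableT).
rewrite [in RHS](eq_bigr (fun=> e)) => [|i _]; last by rewrite /q ltn_ord.
rewrite prodr_const card_ord => <-; apply: eq_integral => w _; congr (_%:E).
by apply: eq_bigr => i _; rewrite /phi ltn_ord.
Qed.

End independence.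

(** * Gaussian integrals *)

Section gaussian_integral.
Variable R : realType.

Lemma measurable_qform p (Q : 'M[R]_p) :
  measurable_fun setT (fun x : Rvec R p => qform Q (col_of_Rvec x)^T).
Proof.
have -> : (fun x : Rvec R p => qform Q (col_of_Rvec x)^T) =
    (fun x => \sum_j (\sum_i tnth x i * Q i j) * tnth x j).
  apply/funext => x; rewrite /qform trmxK mxE; apply: eq_bigr => j _.
  by rewrite !mxE; congr (_ * _); apply: eq_bigr => i _; rewrite !mxE.
apply: measurable_sum => j; apply: measurable_funM; last exact: measurable_tnth.
apply: measurable_sum => i; apply: measurable_funM; first exact: measurable_tnth.
exact: measurable_cst.
Qed.

Lemma integral_gauss_line (q m r : R) : 0 < q ->
  (\int[@lebesgue_measure R]_t (expR (- (q * (t + m) ^+ 2 + r) / 2))%:E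
   = (Num.sqrt (2 * pi / q) * expR (- r / 2))%:E)%E.
Proof.
move=> q0; pose s := (Num.sqrt q)^-1.
have s0 : s != 0 by rewrite invr_neq0// sqrtr_eq0 -ltNge.
have sq : s ^+ 2 = q^-1 by rewrite exprVn sqr_sqrtr// ltW.
have pE : normal_peak s = (Num.sqrt (2 * pi / q))^-1.
  by rewrite /normal_peak sq; congr (Num.sqrt _)^-1; rewrite -mulr_natl; ring.
have K0 : 0 < Num.sqrt (2 * pi / q).
  by rewrite sqrtr_gt0 divr_gt0// mulr_gt0// pi_gt0.
have -> : (fun t => (expR (- (q * (t + m) ^+ 2 + r) / 2))%:E) =
    (fun t => (Num.sqrt (2 * pi / q) * expR (- r / 2))%:E *
              (normal_pdf (- m) s t)%:E)%E.
  apply/funext => t; rewrite -EFinM /normal_pdf (negPf s0) pE.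
  rewrite mulrACA divff ?gt_eqF// mul1r /normal_fun -expRD sq opprK.
  by congr (expR _)%:E; rewrite -mulr_natr; field; rewrite gt_eqF.
rewrite ge0_integralZl//; last 2 first.
- by apply/measurable_EFinP; exact: measurable_normal_pdf.
- by move=> x _; rewrite lee_fin normal_pdf_ge0.
by rewrite integral_normal_pdf mule1.
Qed.

Definition posdef p (Q : 'M[R]_p) :=
  Q^T = Q /\ forall v, v != 0 -> 0 < qform Q v.

Lemma loewner_posdef l u n (Q : 'M[R]_n) : 0 < l -> loewner l u Q -> posdef Q.
Proof.
move=> l0 [symQ bQ]; split=> // v /fro2_gt0 v0.
by have /andP[+ _] := bQ v; apply: lt_le_trans; rewrite mulr_gt0.
Qed.

Section schur_complement.
Variables (p : nat) (Q : 'M[R]_(1 + p)).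
Hypothesis Qpd : posdef Q.

Let q := Q 0 0.
Let b := ursubmx Q.
Definition schur : 'M[R]_p := drsubmx Q - q^-1 *: (b^T *m b).

Let QE : Q = block_mx q%:M b b^T (drsubmx Q).
Proof.
rewrite -[LHS]submxK; congr block_mx.
  apply/matrixP => i j; rewrite !ord1 !mxE mulr1n; congr (Q _ _); exact/val_inj.
by rewrite /b trmx_ursub Qpd.1.
Qed.

Lemma schur_pivot_gt0 : 0 < Q 0 0.
Proof.
have := Qpd.2 (delta_mx 0 0); rewrite /qform -rowE trmx_delta -colE !mxE; apply.
by apply/eqP => /rowP/(_ 0); rewrite !mxE => /eqP; rewrite oner_eq0.
Qed.

(** Completion of the square in the first coordinate. *)
Lemma qform_schur (t : R) (v : 'rV[R]_p) :
  qform Q (row_mx t%:M v) =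
  Q 0 0 * (t + (b *m v^T) 0 0 / Q 0 0) ^+ 2 + qform schur v.
Proof.
have q0 := schur_pivot_gt0; rewrite -/q in q0 *.
rewrite {1}QE /qform mul_row_block tr_row_mx mul_row_col mulmxDl mulmxDl.
rewrite tr_scalar_mx !mul_mx_scalar !mul_scalar_mx /schur mulmxBr mulmxBl.
have -> : v *m b^T = (b *m v^T)^T by rewrite trmx_mul trmxK.
have -> : v *m (q^-1 *: (b^T *m b)) *m v^T =
    q^-1 *: ((b *m v^T)^T *m (b *m v^T)).
  by rewrite -scalemxAr -scalemxAl trmx_mul trmxK !mulmxA.
have -> : t *: b *m v^T = t *: (b *m v^T) by rewrite -scalemxAl.
move: (b *m v^T) => B; move: (v *m drsubmx Q *m v^T) => D.
rewrite !mxE !big_ord1 !mxE /= mulr1n; field; exact: lt0r_neq0.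
Qed.

(** Gaussian elimination of the first column. *)
Lemma det_schur : \det Q = Q 0 0 * \det schur.
Proof.
have q0 := schur_pivot_gt0; rewrite -/q in q0 *.
have -> : Q = block_mx 1%:M 0 (q^-1 *: b^T) 1%:M *m block_mx q%:M b 0 schur.
  rewrite mulmx_block !mul1mx !mul0mx !addr0 {1}QE /schur.
  congr block_mx.
    by rewrite mul_mx_scalar scalerA divff ?scale1r// gt_eqF.
  by rewrite -scalemxAl addrC subrK.
rewrite det_mulmx det_lblock det_ublock !det1 !mul1r; congr (_ * _).
by rewrite det_scalar1.
Qed.

Lemma posdef_schur : posdef schur.
Proof.
have q0 := schur_pivot_gt0; split=> [|v v0].
  rewrite /schur linearB linearZ /= trmx_mul trmxK; congr (_ - _).
  by rewrite trmx_drsub Qpd.1.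
have := Qpd.2 (row_mx (- ((b *m v^T) 0 0 / Q 0 0))%:M v).
rewrite qform_schur addNr expr0n mulr0 add0r; apply.
apply: contraNneq v0 => /(congr1 rsubmx); rewrite row_mxKr => ->.
by apply/eqP/rowP => j; rewrite !mxE.
Qed.

End schur_complement.

Lemma posdef_det_gt0 p (Q : 'M[R]_p) : posdef Q -> 0 < \det Q.
Proof.
elim: p Q => [|p IH] Q Qpd; first by rewrite det_mx00.
rewrite (det_schur (p := p) Qpd) mulr_gt0 ?schur_pivot_gt0// IH//.
exact: posdef_schur.
Qed.

(** By Tonelli the first coordinate is integrated first. It contributes a Gaussian integral on
    the line, shifted by the other coordinates, and leaves the quadratic form of the Schur
    complement, to which induction applies. *)
Lemma gaussian_integral p (Q : 'M[R]_p) : posdef Q ->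
  (\int[tuple_measure (@lebesgue_measure R) p]_x
     (expR (- qform Q (col_of_Rvec x)^T / 2))%:E
   = (Num.sqrt ((2 * pi) ^+ p / \det Q))%:E)%E.
Proof.
elim: p Q => [|p IH] Q Qpd.
  rewrite /= integral_dirac//; last first.
    apply/measurable_EFinP; apply: measurableT_comp => //.
    apply: measurable_funM => //; apply: measurableT_comp => //.
    exact: measurable_qform.
  rewrite diracT mul1e /qform det_mx00 expr0 divr1 sqrtr1.
  by rewrite mxE big_ord0 oppr0 mul0r expR0.
pose nu := tuple_measure (@lebesgue_measure R) p.
pose f (x : Rvec R p.+1) := (expR (- qform Q (col_of_Rvec x)^T / 2))%:E.
have mf : measurable_fun setT f.
  apply/measurable_EFinP; apply: measurableT_comp => //.
  apply: measurable_funM => //; apply: measurableT_comp => //.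
  exact: measurable_qform.
have mfc : measurable_fun setT (f \o @cons_pair _ _ p).
  apply: measurableT_comp => //; exact: measurable_cons_pair.
transitivity (\int[pushforward (@lebesgue_measure R \x nu)%E (@cons_pair _ _ p)]_x f x)%E.
  by [].
rewrite ge0_integral_pushforward//; last 2 first.
- exact: measurable_cons_pair.
- by move=> x _; rewrite lee_fin expR_ge0.
rewrite preimage_setT fubini_tonelli2//; last first.
  by move=> x; rewrite lee_fin expR_ge0.
have q0 := @schur_pivot_gt0 p Q Qpd.
transitivity (\int[nu]_y ((Num.sqrt (2 * pi / Q 0 0))%:E *
   (expR (- qform (schur (p := p) Q) (col_of_Rvec y)^T / 2))%:E))%E.
  apply: eq_integral => y _; rewrite /fubini_G /= -EFinM.
  rewrite -(integral_gauss_line ((@ursubmx R 1 p 1 p Q *m col_of_Rvec y) 0 0 / Q 0 0))//.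
  apply: eq_integral => t _; rewrite /f; congr (expR (_ / 2))%:E; congr -%R.
  have -> : (col_of_Rvec (cons_pair (t, y)))^T =
      row_mx t%:M (col_of_Rvec y)^T :> 'rV[R]_(1 + p).
    apply/rowP => i; rewrite !mxE; case: split_ordP => j ->.
      by rewrite !ord1 !mxE.
    rewrite !mxE (_ : rshift 1 j = lift ord0 j :> 'I_p.+1); last exact: val_inj.
    by rewrite tnthS; congr (tnth _ j); exact: val_inj.
  have e := qform_schur (p := p) Qpd t (col_of_Rvec y)^T.
  by rewrite trmxK in e; exact: e.
rewrite ge0_integralZl//; last first.
  apply/measurable_EFinP; apply: measurableT_comp => //.
  apply: measurable_funM => //; apply: measurableT_comp => //.
  exact: measurable_qform.
rewrite IH; last exact: posdef_schur.
rewrite -EFinM -sqrtrM; last by rewrite divr_ge0 ?ltW// mulr_gt0 ?pi_gt0.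
congr (Num.sqrt _)%:E; rewrite (det_schur (p := p) Qpd) exprS.
have := posdef_det_gt0 (posdef_schur Qpd) => d0.
by field; rewrite !gt_eqF.
Qed.

End gaussian_integral.

(** * Fractional moments of likelihood ratios *)

Section likelihood_ratio.
Variable R : realType.

Definition log_pdf p (S : 'M[R]_p) (x : Rvec R p) : R :=
  (ln (\det (invmx S)) - p%:R * ln (2 * pi) - qform (invmx S) (col_of_Rvec x)^T) / 2.

Lemma two_pi_gt0 : 0 < 2 * pi :> R.
Proof. by rewrite mulr_gt0// pi_gt0. Qed.

Lemma sqrt_expR (a : R) : Num.sqrt (expR a) = expR (a / 2).
Proof.
have -> : expR a = expR (a / 2) ^+ 2 by rewrite expr2 -expRD; congr expR; field.
by rewrite sqrtr_sqr ger0_norm// expR_ge0.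
Qed.

Lemma expR_ln_pow p : expR (p%:R * ln (2 * pi)) = (2 * pi) ^+ p :> R.
Proof. by rewrite expRM_natl lnK// posrE two_pi_gt0. Qed.

Lemma mvnormal_pdf_expR p (S : 'M[R]_p) x : 0 < \det S ->
  mvnormal_pdf S x = expR (log_pdf S x).
Proof.
move=> dS; rewrite /mvnormal_pdf /log_pdf det_inv lnV ?posrE//.
rewrite -expR_ln_pow -[\det S in LHS]lnK ?posrE// -expRD sqrt_expR -expRN -expRD.
by congr expR; rewrite /qform trmxK; field.
Qed.

Lemma measurable_log_pdf p (S : 'M[R]_p) : measurable_fun setT (log_pdf S).
Proof.
apply: measurable_funM => //; apply: measurable_funB => //.
exact: measurable_qform.
Qed.

Lemma gaussian_integral_expR p (Q : 'M[R]_p) : posdef Q ->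
  (\int[@lebesgue_Rvec R p]_x (expR (- qform Q (col_of_Rvec x)^T / 2))%:E
   = (expR ((p%:R * ln (2 * pi) - ln (\det Q)) / 2))%:E)%E.
Proof.
move=> Qpd; rewrite -sqrt_expR expRD expRN expR_ln_pow lnK ?posrE ?posdef_det_gt0//.
exact: gaussian_integral.
Qed.

Lemma integral_density d (W : measurableType d) (P : probability W R) p
    (Y : {RV P >-> Rvec R p}) (S0 : 'M[R]_p) (g : Rvec R p -> R) :
  0 < \det S0 ->
  (forall A, measurable A -> distribution P Y A = mvnormal_prob S0 A) ->
  measurable_fun setT g -> (forall x, 0 <= g x) ->
  (\int[P]_w (g (Y w))%:E =
   \int[@lebesgue_Rvec R p]_x (expR (log_pdf S0 x) * g x)%:E)%E.
Proof.
move=> dS YS mg g0.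
have mp : measurable_fun setT (fun x => expR (log_pdf S0 x)).
  by apply: measurableT_comp => //; exact: measurable_log_pdf.
have mEg : measurable_fun setT (EFin \o g) by exact/measurable_EFinP.
have -> : (\int[P]_w (g (Y w))%:E = \int[distribution P Y]_x (g x)%:E)%E.
  by rewrite ge0_integral_distribution.
have tr := @ge0_integral_transfer _ _ _ _ R (@lebesgue_Rvec R p)
  (distribution P Y) id (fun x => expR (log_pdf S0 x)) 1.
rewrite -[LHS]mul1e -(tr _ mp _ _ (EFin \o g))//.
move=> A mA; rewrite mul1e; transitivity (mvnormal_prob S0 A); last exact/esym/YS.
rewrite /mvnormal_prob [RHS]integral_mkcond.
apply: eq_integral => x _; rewrite /patch indicE.
by case: (x \in A); rewrite ?mule1 ?mule0// mvnormal_pdf_expR.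
Qed.

Section fractional_moment.
Variables (p : nat) (S0 S S1 : 'M[R]_p) (al : R).
Let A0 := invmx S0.
Let A := invmx S.
Let A1 := invmx S1.
Let Q := A0 + al *: (A - A1).
Hypotheses (dS0 : 0 < \det S0) (Qpd : posdef Q).

(** The exponent of the integrand is again a quadratic form, with matrix [Q]. *)
Lemma integral_fractional_ratio :
  (\int[@lebesgue_Rvec R p]_x
     (expR (log_pdf S0 x) * expR (al * (log_pdf S x - log_pdf S1 x)))%:E =
   (expR ((al * (ln (\det A) - ln (\det A1)) + ln (\det A0) - ln (\det Q)) / 2))%:E)%E.
Proof.
transitivity (\int[@lebesgue_Rvec R p]_x
  ((expR ((al * (ln (\det A) - ln (\det A1)) + ln (\det A0)
     - p%:R * ln (2 * pi)) / 2))%:E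
   * (expR (- qform Q (col_of_Rvec x)^T / 2))%:E))%E.
  apply: eq_integral => x _; rewrite -EFinM -!expRD; congr (expR _)%:E.
  by rewrite /log_pdf /Q qformD qformZ qformD qformN -/A -/A1 -/A0; field.
rewrite ge0_integralZl//; last first.
  apply/measurable_EFinP; apply: measurableT_comp => //.
  apply: measurable_funM => //; apply: measurableT_comp => //.
  exact: measurable_qform.
rewrite gaussian_integral_expR// -EFinM -expRD; congr (expR _)%:E.
by field.
Qed.

Lemma expectation_fractional_ratio d (W : measurableType d) (P : probability W R)
    n (X : 'I_n -> {RV P >-> Rvec R p}) : iid_mvnormal X S0 ->
  (\int[P]_w (expR (al * \sum_i (log_pdf S (X i w) - log_pdf S1 (X i w))))%:E =
   (expR (n%:R * ((al * (ln (\det A) - ln (\det A1)) + ln (\det A0)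
     - ln (\det Q)) / 2)))%:E)%E.
Proof.
move=> [indX XS0]; rewrite expRM_natl.
have mg : measurable_fun setT
    (fun x => expR (al * (log_pdf S x - log_pdf S1 x)) : R).
  apply: measurableT_comp => //; apply: measurable_funM => //.
  by apply: measurable_funB; exact: measurable_log_pdf.
rewrite -(expectation_prod_iid indX mg) => [||i].
- apply: eq_integral => w _; rewrite -expR_sum; congr (expR _)%:E.
  by rewrite mulr_sumr.
- by move=> x; exact: expR_ge0.
- rewrite (integral_density dS0 (XS0 i) mg); last by move=> x; exact: expR_ge0.
  exact: integral_fractional_ratio.
Qed.

End fractional_moment.

Lemma likelihood_expR p n (x : 'I_n -> Rvec R p) (S : 'M[R]_p) : 0 < \det S ->
  likelihood x S = expR (\sum_i log_pdf S (x i)).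
Proof.
by move=> dS; rewrite expR_sum; apply: eq_bigr => i _; rewrite mvnormal_pdf_expR.
Qed.

End likelihood_ratio.

(** * Entropy of the sparse factor models *)

Section factor_geometry.
Variables (R : realType) (p : nat) (L : R).
Hypothesis L1 : 1 < L.

Lemma frobeniusE m n (A : 'M[R]_(m, n)) : frobenius A ^+ 2 = fro2 A.
Proof. by rewrite sqr_sqrtr// fro2_ge0. Qed.

Let L0 : 0 < L. Proof. exact: lt_trans L1. Qed.

(** An eigenvalue [a >= 0] of the Gram matrix is the square of the singular value [sqrt a]. *)
Lemma loading_gram k s (A : 'M[R]_(p, k)) : loading_class L s A ->
  loewner 0 L (A^T *m A).
Proof.
move=> [_ sA]; apply: eigenvalue_loewner; first by rewrite trmx_mul trmxK.
move=> a ea; have a0 : 0 <= a.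
  have /eigenvalueP[v vE v0] := ea.
  rewrite -(pmulr_lge0 _ (fro2_gt0 v0)).
  have -> : a * fro2 v = qform (A^T *m A) v.
    by rewrite /qform vE -scalemxAl mxE fro2E /mxtrace big_ord1.
  have := qform_conj 1%:M A^T v; rewrite trmxK mulmx1 => ->.
  by rewrite qform_fro2 fro2_ge0.
have sa : singular_value A (Num.sqrt a).
  by split; rewrite ?sqrtr_ge0// sqr_sqrtr.
by have := sA _ sa; rewrite a0 /= ger0_norm ?sqrtr_ge0// ler_sqrt // ltW.
Qed.

Lemma loading_trmx_bound k s m (A : 'M[R]_(p, k)) (M : 'M[R]_(m, k)) :
  loading_class L s A -> fro2 (M *m A^T) <= L * fro2 M.
Proof.
move=> /loading_gram[_ gA]; rewrite fro2_row [fro2 M]fro2_row mulr_sumr.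
apply: ler_sum => i _; rewrite row_mul -qform_fro2 -qform_conj mulmx1 trmxK.
by have /andP[] := gA (row i M).
Qed.

(** The bound on [A^T A] passes to [A A^T]: expand [|L M - M A A^T|^2 >= 0] and use
    [|M A A^T|^2 <= L |M A|^2], the bound for the transpose. *)
Lemma loading_bound k s m (A : 'M[R]_(p, k)) (M : 'M[R]_(m, p)) :
  loading_class L s A -> fro2 (M *m A) <= L * fro2 M.
Proof.
move=> cA; have h := loading_trmx_bound (M *m A) cA.
have h2 : fro2 (L *: M - M *m A *m A^T) =
    L ^+ 2 * fro2 M - 2 * L * fro2 (M *m A) + fro2 (M *m A *m A^T).
  have -> : fro2 (M *m A) = \tr (M *m (M *m A *m A^T)^T).
    by rewrite fro2E !trmx_mul trmxK !mulmxA.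
  rewrite /mxtrace /fro2 !mulr_sumr -sumrN -!big_split /=; apply: eq_bigr => i _.
  move: (M *m A *m A^T) => X; rewrite [X in 2 * L * X]mxE.
  rewrite !mulr_sumr -sumrN -!big_split /=.
  by apply: eq_bigr => j _; rewrite !mxE; ring.
have := fro2_ge0 (L *: M - M *m A *m A^T); rewrite h2.
have := fro2_ge0 M; have := fro2_ge0 (M *m A).
move: h; move: (fro2 M) (fro2 (M *m A)) (fro2 _) => f fA fAA h fA0 f0 h3.
have : L * (L * f - fA) >= 0 by lra.
by rewrite pmulr_rge0// subr_ge0.
Qed.

Lemma factor_loewner k s (S : 'M[R]_p) : factor_model L k s S ->
  loewner 1 (1 + L) S.
Proof.
move=> [A cA <-]; split=> [|v].
  by rewrite linearD /= trmx_mul trmxK trmx1.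
rewrite qformD qform_fro2; have := qform_conj 1%:M A v; rewrite mulmx1 => ->.
rewrite qform_fro2; have := loading_bound v cA; have := fro2_ge0 (v *m A).
by move=> h1 h2; apply/andP; split; lra.
Qed.

(** [A A^T - B B^T = A (A - B)^T + (A - B) B^T], and the factors [A] and [B^T] have operator
    norm at most [sqrt L]. *)
Lemma factor_lipschitz k s (A B : 'M[R]_(p, k)) :
  loading_class L s A -> loading_class L s B ->
  fro2 ((A *m A^T + 1%:M) - (B *m B^T + 1%:M)) <= 4 * L * fro2 (A - B).
Proof.
move=> cA cB.
have -> : (A *m A^T + 1%:M) - (B *m B^T + 1%:M) =
    A *m (A - B)^T + (A - B) *m B^T.
  by rewrite linearB /= mulmxBr mulmxBl opprD addrACA subrr addr0 addrA subrK.
apply: (le_trans (fro2D _ _)).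
have := loading_trmx_bound (A - B) cB.
have := loading_trmx_bound (A - B) cA.
by rewrite -[A *m _^T]trmxK trmx_mul trmxK fro2_tr; lra.
Qed.

Lemma loading0 k s : loading_class L s (0 : 'M[R]_(p, k)).
Proof.
split=> [j|sg].
  rewrite /B0 /= (eq_card0 (A := _))// => i.
  by rewrite !inE !mxE eqxx.
rewrite /singular_value mulmx0 => -[s0 /eigenvalueP[v]].
rewrite mulmx0 => /esym/eqP; rewrite scaler_eq0 sqrf_eq0 => /orP[/eqP-> _|->//].
by rewrite normr0 sqrtr_ge0.
Qed.

(** The columns of [A] have length at most [sqrt L], which is at most [L]. *)
Lemma loading_entry k s (A : 'M[R]_(p, k)) i j : loading_class L s A ->
  - L <= A i j <= L.
Proof.
move=> cA; have := loading_trmx_bound (delta_mx 0 j : 'rV_k) cA.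
rewrite -rowE; have -> : fro2 (delta_mx 0 j : 'rV[R]_k) = 1.
  rewrite /fro2 big_ord1 (bigD1 j)//= big1 => [|l lj]; rewrite !mxE ?eqxx /=.
    by rewrite expr1n addr0.
  by rewrite (negPf lj) expr0n.
rewrite /fro2 big_ord1 (bigD1 i)//= !mxE mulr1 => h.
have h2 : A i j ^+ 2 <= L.
  by apply: le_trans h; rewrite lerDl sumr_ge0// => *; exact: sqr_ge0.
rewrite -ler_norml -ler_sqr ?nnegrE ?(ltW L0)// real_normK ?num_real//.
by apply: (le_trans h2); rewrite expr2 ler_peMl // ltW.
Qed.

Section coding.
Variables (n k s : nat).
Hypotheses (n0 : (0 < n)%N) (p0 : (0 < p)%N).

(** Loading matrices are coded by the positions of their nonzero entries and, for each of them,
    by a cell of a grid of mesh [1 / (2 L n)] on the interval [-L, L] of possible entries. *)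
Definition grid_size : nat := (Num.truncn (4 * L ^+ 2 * n%:R)).+1.

Definition grid_step (a : R) : nat := Num.truncn ((a + L) * (2 * L * n%:R)).

(** Beyond the support of [v] the position defaults to the first coordinate, whose entry is
    then coded as well. *)
Definition support_nth (v : 'cV[R]_p) (t : nat) : 'I_p :=
  nth (Ordinal p0) (enum [pred i | (v i 0 != 0)%R]) t.

Definition loading_code (A : 'M[R]_(p, k)) :
    {ffun 'I_k * 'I_s -> 'I_p * 'I_grid_size} :=
  [ffun jt : 'I_k * 'I_s => let i := support_nth (col jt.1 A) jt.2 in
              (i, inord (grid_step (A i jt.1)))].

Let c0 : 0 < 2 * L * n%:R.
Proof. by rewrite !mulr_gt0// ltr0n. Qed.

Lemma grid_step_lt (a : R) : - L <= a <= L -> (grid_step a < grid_size)%N.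
Proof.
move=> /andP[a1 a2]; rewrite ltnS le_truncn//.
have : (a + L) * (2 * L * n%:R) <= (2 * L) * (2 * L * n%:R).
  by rewrite ler_pM2r//; lra.
by move=> /le_trans; apply; rewrite le_eqVlt; apply/orP; left; apply/eqP; ring.
Qed.

Lemma grid_step_close (a b : R) : - L <= a <= L -> - L <= b <= L ->
  grid_step a = grid_step b -> (a - b) ^+ 2 <= ((2 * L * n%:R) ^+ 2)^-1.
Proof.
move=> /andP[a1 a2] /andP[b1 b2] e.
have ta : 0 <= (a + L) * (2 * L * n%:R) by rewrite pmulr_lge0//; lra.
have tb : 0 <= (b + L) * (2 * L * n%:R) by rewrite pmulr_lge0//; lra.
have /andP[] := truncn_itv ta; have /andP[] := truncn_itv tb.
rewrite -/(grid_step a) -/(grid_step b) e -natr1 => u1 u2 u3 u4.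
have h : ((a - b) * (2 * L * n%:R)) ^+ 2 <= 1.
  have -> : (a - b) * (2 * L * n%:R) =
    (a + L) * (2 * L * n%:R) - (b + L) * (2 * L * n%:R) by ring.
  by rewrite expr2; nra.
by rewrite -[leRHS]mul1r ler_pdivlMr ?exprn_gt0// -exprMn.
Qed.

Lemma support_nth_mem (v : 'cV[R]_p) i : B0 s v -> v i 0 != 0 ->
  exists t : 'I_s, support_nth v t = i.
Proof.
move=> sv vi; have im : i \in enum [pred i | (v i 0 != 0)%R] by rewrite mem_enum.
have lt : (index i (enum [pred i | (v i 0 != 0)%R]) < s)%N.
  by apply: leq_trans sv; rewrite cardE index_mem.
by exists (Ordinal lt); rewrite /support_nth nth_index.
Qed.

(** Equal codes list the same positions, and these carry both supports. So in each column the
    difference is supported on at most [s] positions and is at most one mesh at each. *)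
Lemma loading_code_close (A B : 'M[R]_(p, k)) :
  loading_class L s A -> loading_class L s B -> loading_code A = loading_code B ->
  fro2 (A - B) <= (k * s)%:R * ((2 * L * n%:R) ^+ 2)^-1.
Proof.
move=> cA cB eAB; rewrite -fro2_tr natrM -mulrA mulr_natl.
rewrite -[k in leRHS]card_ord -sumr_const; apply: ler_sum => j _.
pose D := imset (fun t : 'I_s => support_nth (col j A) t) (mem 'I_s).
have eD (t : 'I_s) : support_nth (col j A) t = support_nth (col j B) t /\
    grid_step (A (support_nth (col j A) t) j) =
    grid_step (B (support_nth (col j A) t) j).
  have /ffunP/(_ (j, t)) := eAB; rewrite !ffunE /= => -[e1].
  rewrite -e1 => /(congr1 val); rewrite /= !inordK; first by [].
    by apply: grid_step_lt; exact: loading_entry cB.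
  by apply: grid_step_lt; exact: loading_entry cA.
rewrite (bigID (mem D))/= [X in _ + X]big1 ?addr0 => [|i iD]; last first.
  suff [a0 b0] : A i j = 0 /\ B i j = 0 by rewrite !mxE a0 b0 subrr expr0n.
  have [hA hB] := (cA.1 j, cB.1 j).
  split; apply/eqP; apply: contraNT iD => nz.
    have [|t <-] := support_nth_mem (i := i) hA; first by rewrite mxE.
    by apply/imsetP; exists t.
  have [|t] := support_nth_mem (i := i) hB; first by rewrite mxE.
  by rewrite -(eD t).1 => <-; apply/imsetP; exists t.
apply: (@le_trans _ _ (\sum_(i in D) ((2 * L * n%:R) ^+ 2)^-1)).
  apply: ler_sum => i /imsetP[t _ ->]; rewrite !mxE.
  apply: grid_step_close; [exact: loading_entry cA|exact: loading_entry cB|].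
  exact: (eD t).2.
rewrite sumr_const -[leLHS]mulr_natl ler_wpM2r ?invr_ge0 ?sqr_ge0// ler_nat.
by rewrite (leq_trans (leq_imset_card _ _))// card_ord.
Qed.

End coding.
End factor_geometry.

Section nets.
Variables (R : realType) (p : nat).

(** One element of [D] is chosen for each code that occurs, so the net lies in the image. *)
Lemma net_of_code (T : Type) (C : finType) (D : set T) (f : T -> 'M[R]_p)
    (code : T -> C) (r : R) :
  (forall A B, D A -> D B -> code A = code B -> frobenius (f A - f B) <= r) ->
  exists2 N, frobenius_net (f @` D) r N & (size N <= #|C|)%N.
Proof.
move=> close; pose rep c : option 'M[R]_p :=
  if pselect (exists A, D A /\ code A = c) is left e
  then Some (f (projT1 (cid e))) else None.
exists (pmap rep (enum C)); last by rewrite size_pmap cardE count_size.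
split=> [S|S].
  rewrite mem_pmap => /mapP[c _]; rewrite /rep; case: pselect => // e [->].
  by exists (projT1 (cid e)) => //; case: (cid e) => A [].
move=> [A DA <-]; have e : exists B, D B /\ code B = code A by exists A.
have repE : rep (code A) = Some (f (projT1 (cid e))).
  by rewrite /rep; case: pselect => // e'; rewrite (Prop_irrelevance e' e).
exists (f (projT1 (cid e))).
  by rewrite mem_pmap; apply/mapP; exists (code A); rewrite ?mem_enum.
by case: (cid e) => B [DB cB]; apply: close.
Qed.

Lemma minimal_net (F : set 'M[R]_p) r N0 : frobenius_net F r N0 ->
  exists N, [/\ frobenius_net F r N, (size N <= size N0)%N &
    forall N', frobenius_net F r N' -> (size N <= size N')%N].
Proof.
move=> F0; pose P m := `[< exists2 N, frobenius_net F r N & size N = m >].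
have exP : exists m, P m by exists (size N0); apply/asboolP; exists N0.
have [m /asboolP[N FN sN] min] := ex_minnP exP; subst m.
have minN N' : frobenius_net F r N' -> (size N <= size N')%N.
  by move=> FN'; apply: min; apply/asboolP; exists N'.
by exists N; split => //; exact: minN.
Qed.

(** * Uniform priors on nets *)

Section uniform_prior.
Variables (N : seq 'M[R]_p) (N0 : (0 < size N)%N).

(** The proof argument lets the measure be declared a probability. *)
Definition uniform_prior (_ : (0 < size N)%N) : set (mxBorel R p) -> \bar R :=
  mscale ((size N)%:R^-1 : R)%:nng
    (msum (fun i => \d_(nth 0 N i : mxBorel R p)) (size N)).

HB.instance Definition _ := Measure.on (uniform_prior N0).

Lemma uniform_priorE A : uniform_prior N0 A =
  ((size N)%:R^-1%:E * \sum_(S <- N) \d_(S : mxBorel R p) A)%E.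
Proof. by rewrite (big_nth 0) big_mkord. Qed.

Let uniform_priorT : uniform_prior N0 setT = 1%E.
Proof.
rewrite uniform_priorE (eq_bigr (fun=> 1%:E)) => [|S _]; last by rewrite diracT.
rewrite sumEFin big_const_seq count_predT iter_addr_0 -EFinM mulVf//.
by rewrite pnatr_eq0 -lt0n.
Qed.

HB.instance Definition _ :=
  @Measure_isProbability.Build _ _ R (uniform_prior N0) uniform_priorT.

Lemma integral_uniform_prior (Pi : {measure set (mxBorel R p) -> \bar R})
    (f : mxBorel R p -> \bar R) :
  (forall A, measurable A -> Pi A = uniform_prior N0 A) ->
  measurable_fun setT f -> (forall x, (0 <= f x)%E) ->
  (\int[Pi]_x f x = (size N)%:R^-1%:E * \sum_(S <- N) f S)%E.
Proof.
move=> PiE mf f0.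
rewrite (eq_measure_integral (uniform_prior N0)); last by move=> A mA _; exact: PiE.
rewrite /uniform_prior ge0_integral_mscale// ge0_integral_measure_sum//.
congr (_ * _)%E; rewrite (big_nth 0) big_mkord; apply: eq_bigr => i _.
by rewrite integral_dirac// diracT mul1e.
Qed.

End uniform_prior.
End nets.

Section sieve.
Variables (R : realType) (L : R) (L1 : 1 < L).

Let L0 : 0 < L. Proof. exact: lt_trans L1. Qed.

(** Bound for the metric entropy per unit of complexity. *)
Definition entropy_const : R := 4 * L ^+ 2 + 3.

Lemma complexityE p k s : (0 < p)%N ->
  complexity R p k s = (k * s)%:R * (1 + ln p%:R).
Proof.
by move=> p0; rewrite /complexity lnM ?posrE ?expR_gt0 ?ltr0n// expRK.
Qed.

Lemma ln_natr_ge0 p : 0 <= ln p%:R :> R.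
Proof.
by case: p => [|p]; [rewrite ln0|rewrite ln_ge0// ler1n].
Qed.

(** This is where [n <= p] enters: one of about [n] grid cells costs [ln n <= ln p], no more
    than one of [p] positions. *)
Lemma code_count n p k s : (0 < n)%N -> (n <= p)%N ->
  ((p * grid_size L n) ^ (k * s))%:R <= expR (entropy_const * complexity R p k s).
Proof.
move=> n0 np; have p0 : (0 < p)%N by apply: leq_trans np.
rewrite complexityE// mulrCA expRM_natl natrX lerXn2r ?nnegrE ?ler0n ?expR_ge0//.
have pE : p%:R = expR (ln p%:R) :> R by rewrite lnK// posrE ltr0n.
have gE : (grid_size L n)%:R <= (4 * L ^+ 2 + 1) * p%:R.
  rewrite /grid_size -[leLHS]natr1.
  have h : (Num.truncn (4 * L ^+ 2 * n%:R))%:R <= 4 * L ^+ 2 * n%:R.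
    by rewrite truncn_le mulr_ge0// mulr_ge0// sqr_ge0.
  have h2 : n%:R <= p%:R :> R by rewrite ler_nat.
  have h3 : 1 <= p%:R :> R by rewrite ler1n.
  have h4 : 4 * L ^+ 2 * n%:R <= 4 * L ^+ 2 * p%:R.
    by rewrite ler_wpM2l// mulr_ge0// sqr_ge0.
  by lra.
rewrite natrM; apply: (@le_trans _ _ (p%:R * ((4 * L ^+ 2 + 1) * p%:R))).
  by rewrite ler_wpM2l.
have e1 : 4 * L ^+ 2 + 1 <= expR (4 * L ^+ 2 + 1).
  by apply: le_trans (expR_ge1Dx _); lra.
apply: (@le_trans _ _ (expR (4 * L ^+ 2 + 1 + 2 * ln p%:R))).
  rewrite expRD expRM_natl -pE mulrCA -expr2 ler_wpM2r// sqr_ge0//.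
rewrite ler_expR /entropy_const; have := ln_natr_ge0 p; have := sqr_ge0 L.
by move: (ln _) => x y0 x0; nra.
Qed.

(** What the contraction argument uses of a sieve prior of the model [(k, s)]: its atoms,
    the entropy bound, and the covering radius, which is of the order of the rate. *)
Definition net_prior n p k s (Pi : probability (mxBorel R p) R) (N : seq 'M[R]_p) :=
  [/\ exists N0 : (0 < size N)%N,
        forall A, measurable A -> Pi A = uniform_prior N0 A,
      forall S, S \in N -> factor_model L k s S,
      (size N)%:R <= expR (entropy_const * complexity R p k s) &
      forall S, factor_model L k s S -> exists2 S', S' \in N &
        fro2 (S - S') <= (k * s)%:R / n%:R].

Section existence.
Variables (n p : nat).
Hypotheses (n0 : (0 < n)%N) (np : (n <= p)%N).

Let p0 : (0 < p)%N. Proof. exact: leq_trans np. Qed.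

(** The code of mesh [1 / (2 L n)] gives a net of radius [sqrt (k s / n)]: the squared loading
    error [k s / (2 L n)^2] is multiplied by [4 L]. A minimal net is at most as large. *)
Lemma exists_sieve k s : (0 < k)%N -> (0 < s)%N ->
  exists (Pi : probability (mxBorel R p) R) (N : seq 'M[R]_p),
    sieve_prior (factor_model L k s) Pi /\ net_prior n k s Pi N.
Proof.
move=> k0 s0; pose r : R := Num.sqrt ((k * s)%:R / n%:R).
have r0 : 0 < r by rewrite sqrtr_gt0 divr_gt0// ltr0n ?muln_gt0 ?k0.
pose D : set 'M[R]_(p, k) := loading_class L s.
have close (A B : 'M[R]_(p, k)) : D A -> D B ->
    loading_code L n s p0 A = loading_code L n s p0 B ->
    frobenius ((A *m A^T + 1%:M) - (B *m B^T + 1%:M)) <= r.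
  move=> DA DB e; rewrite /frobenius ler_sqrt; last first.
    by rewrite divr_ge0.
  apply: (le_trans (factor_lipschitz L1 DA DB)).
  have h := loading_code_close L1 n0 DA DB e.
  apply: (@le_trans _ _ (4 * L * ((k * s)%:R * ((2 * L * n%:R) ^+ 2)^-1))).
    by rewrite ler_wpM2l// mulr_ge0// ltW.
  have n0' : 0 < n%:R :> R by rewrite ltr0n.
  have -> : 4 * L * ((k * s)%:R * ((2 * L * n%:R) ^+ 2)^-1) =
      (k * s)%:R / n%:R * (L * n%:R)^-1.
    by field; rewrite !gt_eqF.
  rewrite ler_piMr ?divr_ge0// invf_le1 ?mulr_gt0//.
  have n1 : 1 <= n%:R :> R by rewrite ler1n.
  by apply: (le_trans n1); rewrite ler_peMl// ltW.
have [Nc Fc sc] := net_of_code close.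
have [N [FN sN minN]] := minimal_net Fc.
have N0 : (0 < size N)%N.
  have [|S' S'N _] := FN.2 1%:M.
    exists 0; first exact: loading0.
    by rewrite trmx0 mulmx0 add0r.
  by case: (N) S'N.
exists (uniform_prior N0), N; split.
  by exists r, N; split => // A mA; exact: uniform_priorE.
split.
- by exists N0.
- exact: FN.1.
- apply: le_trans (code_count k s n0 np); rewrite ler_nat.
  apply: (leq_trans sN); apply: (leq_trans sc).
  by rewrite card_ffun !card_prod !card_ord.
- move=> S /FN.2[S' S'N SS']; exists S' => //.
  rewrite -frobeniusE -[leRHS]sqr_sqrtr ?divr_ge0//.
  by rewrite ler_sqr ?nnegrE ?sqrtr_ge0.
Qed.

End existence.
End sieve.

(** * Integrals against the overall prior *)

Section lower_integral.
Context d (T : measurableType d) (R : realType).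
Variable mu : {measure set T -> \bar R}.
Local Open Scope ereal_scope.
Import HBNNSimple.

(** The integral of a nonnegative function is a supremum over simple functions below it, for
    every function and every domain. The comparisons below therefore apply to the likelihood
    as a function of the covariance matrix and to the posterior as a function of the data,
    whatever the set whose posterior mass is taken. *)
Lemma ge0_integral_le (D : set T) (f : T -> \bar R) (M : \bar R) :
  (forall x, D x -> 0 <= f x) ->
  (forall h : {nnsfun T >-> R}, (forall x, (h x)%:E <= (f \_ D) x) ->
    \int[mu]_x (h x)%:E <= M) ->
  \int[mu]_(x in D) f x <= M.
Proof.
move=> f0 hM; rewrite ge0_integralE//; apply: ge_ereal_sup => _ [h /= hf <-].
by rewrite -integralT_nnsfun hM.
Qed.

Lemma ge0_le_integral_patch (D E : set T) (f g : T -> \bar R) :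
  (forall x, D x -> 0 <= f x) -> (forall x, E x -> 0 <= g x) ->
  (forall x, (f \_ D) x <= (g \_ E) x) ->
  \int[mu]_(x in D) f x <= \int[mu]_(x in E) g x.
Proof.
move=> f0 g0 fg; apply: ge0_integral_le => // h hf.
rewrite integralT_nnsfun [leRHS]ge0_integralE//; apply: ereal_sup_ubound.
by exists h => // x; apply: le_trans (fg x).
Qed.

End lower_integral.

Section series.
Variable R : realType.
Local Open Scope ereal_scope.

Lemma nneseries_ge_term (f : nat -> \bar R) j : (forall i, 0 <= f i) ->
  f j <= \sum_(i <oo) f i.
Proof. by move=> f0; rewrite (nneseriesD1 (n := j))// leeDl// nneseries_ge0. Qed.

Lemma nneseries2_ge_term (f : nat -> nat -> \bar R) k s :
  (forall i j, 0 <= f i j) -> f k s <= \sum_(i <oo) \sum_(j <oo) f i j.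
Proof.
move=> f0; apply: le_trans (nneseries_ge_term k _) => [|i].
  exact: (nneseries_ge_term s).
exact: nneseries_ge0.
Qed.

Lemma nneseries2_shift (f : nat -> nat -> \bar R) : (forall i j, 0 <= f i j) ->
  \sum_(1 <= i <oo) \sum_(1 <= j <oo) f i j =
  \sum_(i <oo) \sum_(j <oo) f i.+1 j.+1.
Proof.
move=> f0; rewrite -nneseries_addn; last by move=> i; exact: nneseries_ge0.
by apply: eq_eseriesr => i _; rewrite -nneseries_addn// addn1;
  apply: eq_eseriesr => j _; rewrite addn1.
Qed.

End series.

Lemma ge0_integral_measure_series2 d (T : measurableType d) (R : realType)
    (mu : {measure set T -> \bar R}) (m : nat -> nat -> {measure set T -> \bar R})
    (f : T -> \bar R) :
  (forall A, measurable A ->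
    mu A = (\sum_(1 <= k <oo) \sum_(1 <= s <oo) m k s A)%E) ->
  measurable_fun setT f -> (forall x, (0 <= f x)%E) ->
  (\int[mu]_x f x = \sum_(k <oo) \sum_(s <oo) \int[m k.+1 s.+1]_x f x)%E.
Proof.
move=> muE mf f0; pose m1 k := mseries (fun s => m k.+1 s.+1) 0.
rewrite (eq_measure_integral (mseries m1 0)) => [|A mA _]; last first.
  by rewrite muE// nneseries2_shift.
rewrite ge0_integral_measure_series//; apply: eq_eseriesr => k _.
by rewrite ge0_integral_measure_series.
Qed.

Section discrete_prior.
Variables (R : realType) (p : nat) (c : R).
Variables (Pi : nat -> nat -> probability (mxBorel R p) R).
Variable N : nat -> nat -> seq 'M[R]_p.
Hypothesis PiE : forall k s, (0 < k)%N -> (0 < s)%N ->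
  exists N0 : (0 < size (N k s))%N,
    forall A, measurable A -> Pi k s A = uniform_prior N0 A.

Local Notation prior := (overall_prior c Pi).
Import HBNNSimple.

(** A matrix that lies in the nets of several models is an atom of each of them. *)
Definition atom_weight k s : R := model_prior p c k s / (size (N k s))%:R.

Lemma atom_weight_ge0 k s : 0 <= atom_weight k s.
Proof. by rewrite divr_ge0// model_prior_ge0. Qed.

Lemma measurable_set1_mx (S : 'M[R]_p) : measurable ([set S] : set (mxBorel R p)).
Proof.
have : measurable (~` ~` [set S] : set (mxBorel R p)).
  apply: measurableC; apply: sub_sigma_algebra; apply: closed_openC.
  exact/accessible_closed_set1/hausdorff_accessible/norm_hausdorff.
by rewrite setCK.
Qed.

Lemma integral_overall_prior (f : mxBorel R p -> \bar R) :
  measurable_fun setT f -> (forall x, (0 <= f x)%E) ->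
  (\int[prior]_x f x = \sum_(k <oo) \sum_(s <oo)
     (atom_weight k.+1 s.+1)%:E * \sum_(S <- N k.+1 s.+1) f S)%E.
Proof.
move=> mf f0.
pose m k s : {measure set (mxBorel R p) -> \bar R} :=
  mscale (NngNum (model_prior_ge0 p c k s)) (Pi k s).
transitivity (\sum_(k <oo) \sum_(s <oo) \int[m k.+1 s.+1]_x f x)%E.
  exact: ge0_integral_measure_series2.
apply: eq_eseriesr => k _; apply: eq_eseriesr => s _.
rewrite ge0_integral_mscale//.
have [N0 PE] := PiE (ltn0Sn k) (ltn0Sn s).
by rewrite (integral_uniform_prior PE)// muleA -EFinM.
Qed.

(** A simple function below [f] on [B] and below 0 elsewhere vanishes at the atoms outside
    [B]. *)
Lemma integral_overall_prior_le (B : set (mxBorel R p)) (f : 'M[R]_p -> R) :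
  (forall S, 0 <= f S) ->
  (\int[prior]_(S in B) (f S)%:E <= \sum_(k <oo) \sum_(s <oo)
     \sum_(S <- N k.+1 s.+1 | S \in B) (atom_weight k.+1 s.+1 * f S)%:E)%E.
Proof.
move=> f0; apply: ge0_integral_le => [x _|h hf]; first by rewrite lee_fin.
rewrite integral_overall_prior//; last 2 first.
- exact/measurable_EFinP.
- by move=> x; rewrite lee_fin.
apply: lee_nneseries => [k _ _|k _].
  apply: nneseries_ge0 => s _ _; rewrite mule_ge0 ?lee_fin ?atom_weight_ge0//.
  by apply: sume_ge0 => S _; rewrite lee_fin.
apply: lee_nneseries => [s _ _|s _].
  rewrite mule_ge0 ?lee_fin ?atom_weight_ge0//.
  by apply: sume_ge0 => S _; rewrite lee_fin.
rewrite ge0_sume_distrr; last by move=> S _; rewrite lee_fin.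
rewrite [leRHS]big_mkcond; apply: lee_sum => S _; have := hf S.
rewrite /patch; case: ifP => _ hS.
  by rewrite [leRHS]EFinM lee_wpmul2l// lee_fin atom_weight_ge0.
have -> : (h S)%:E = 0%E by apply/eqP; rewrite eq_le hS lee_fin/=.
by rewrite mule0.
Qed.

(** Restriction of the integral to the singleton of [S]. *)
Lemma integral_overall_prior_ge (f : 'M[R]_p -> R) k s S :
  (0 < k)%N -> (0 < s)%N -> S \in N k s -> (forall S, 0 <= f S) ->
  ((atom_weight k s * f S)%:E <= \int[prior]_S (f S)%:E)%E.
Proof.
move=> k0 s0 SN f0.
pose g (x : mxBorel R p) := (f S * \1_[set S] x)%:E.
apply: (@le_trans _ _ (\int[prior]_x g x)%E); last first.
  apply: ge0_le_integral_patch => [x _|x _|x].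
  - by rewrite lee_fin mulr_ge0.
  - by rewrite lee_fin.
  rewrite !patch_setT /g indicE lee_fin.
  by case: (boolP (x \in [set S])) => [/set_mem ->|_]; rewrite ?mulr1 ?mulr0.
have g0 x : (0 <= g x)%E by rewrite lee_fin mulr_ge0.
rewrite integral_overall_prior//; last first.
  apply/measurable_EFinP; apply: measurable_funM => //.
  by apply: measurable_indic; exact: measurable_set1_mx.
case: k k0 SN => // k _; case: s s0 => // s _ SN.
apply: le_trans (nneseries2_ge_term k s _); last first.
  by move=> i j; rewrite mule_ge0 ?lee_fin ?atom_weight_ge0 ?sume_ge0.
rewrite [leLHS]EFinM lee_wpmul2l ?lee_fin ?atom_weight_ge0//.
rewrite (big_rem S)//= /g indicE mem_set// mulr1 leeDl// sume_ge0// => y _.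
by rewrite lee_fin mulr_ge0.
Qed.

End discrete_prior.

(** * The posterior as a sum over atoms *)

Section posterior_bound.
Variables (R : realType) (p : nat) (c : R).
Variables (Pi : nat -> nat -> probability (mxBorel R p) R).
Variable N : nat -> nat -> seq 'M[R]_p.
Hypothesis PiE : forall k s, (0 < k)%N -> (0 < s)%N ->
  exists N0 : (0 < size (N k s))%N,
    forall A, measurable A -> Pi k s A = uniform_prior N0 A.

Local Notation prior := (overall_prior c Pi).
Local Notation w := (atom_weight c N).

Lemma likelihood_ge0 n (x : 'I_n -> Rvec R p) S : 0 <= likelihood x S.
Proof.
by apply: prodr_ge0 => i _; rewrite mulr_ge0 ?expR_ge0// invr_ge0 sqrtr_ge0.
Qed.

(** Let [D] be the normalising integral. A term [t = w f_S / D] of the posterior mass of [B] is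
    in the unit interval, so [t <= t `^ al], and [D] is at least the term of the atom [S1]. The
    power is taken term by term so that an expectation can later be taken of each term. *)
Lemma posterior_le_sum n (x : 'I_n -> Rvec R p) (B : set 'M[R]_p) (al : R)
    k s S1 : (0 < k)%N -> (0 < s)%N -> S1 \in N k s ->
  0 < al <= 1 -> 0 < w k s * likelihood x S1 ->
  ((posterior prior x B)%:E <=
   \sum_(i <oo) \sum_(j <oo) \sum_(S <- N i.+1 j.+1 | S \in B)
     ((w i.+1 j.+1 * likelihood x S / (w k s * likelihood x S1)) `^ al)%:E)%E.
Proof.
move=> k0 s0 S1N /andP[al0 al1] wS1; have lik0 := likelihood_ge0 x.
set num := (\int[prior]_(S in (B : set (mxBorel R p))) (likelihood x S)%:E)%E.
set den := (\int[prior]_(S in [set: mxBorel R p]) (likelihood x S)%:E)%E.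
have post_E : posterior prior x B = fine num / fine den by [].
have num0 : (0 <= num)%E by apply: integral_ge0 => S _; rewrite lee_fin.
have rhs0 : (0 <= \sum_(i <oo) \sum_(j <oo) \sum_(S <- N i.+1 j.+1 | S \in B)
    ((w i.+1 j.+1 * likelihood x S / (w k s * likelihood x S1)) `^ al)%:E)%E.
  apply: nneseries_ge0 => i _ _; apply: nneseries_ge0 => j _ _.
  by apply: sume_ge0 => S _; rewrite lee_fin powR_ge0.
have den_ge i j S : S \in N i.+1 j.+1 ->
    ((w i.+1 j.+1 * likelihood x S)%:E <= den)%E.
  by move=> SN; apply: (integral_overall_prior_ge c PiE).
have denS1 : ((w k s * likelihood x S1)%:E <= den)%E.
  exact: (integral_overall_prior_ge c PiE).
have numden : (num <= den)%E.
  apply: ge0_le_integral_patch => [S _|S _|S]; rewrite ?lee_fin//.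
  by rewrite patch_setT /patch; case: ifP; rewrite // lee_fin.
rewrite post_E; case: den post_E den_ge denS1 numden => [D| |] _ den_ge denS1 numden.
- have D0 : 0 < D by apply: lt_le_trans wS1 _; rewrite -lee_fin.
  have numE : num = (fine num)%:E.
    by rewrite fineK// ge0_fin_numE// (le_lt_trans numden) ?ltry.
  rewrite /= mulrC EFinM -numE.
  apply: (@le_trans _ _ (D^-1%:E * \sum_(i <oo) \sum_(j <oo)
      \sum_(S <- N i.+1 j.+1 | S \in B) (w i.+1 j.+1 * likelihood x S)%:E)%E).
    rewrite lee_wpmul2l ?lee_fin ?invr_ge0 ?(ltW D0)//.
    exact: (integral_overall_prior_le c PiE).
  rewrite -nneseriesZl; last first.
    move=> i _; apply: nneseries_ge0 => j _ _; apply: sume_ge0 => S _.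
    by rewrite lee_fin mulr_ge0 ?atom_weight_ge0.
  apply: lee_nneseries => [i _ _|i _].
    rewrite mule_ge0 ?lee_fin ?invr_ge0 ?(ltW D0)//.
    apply: nneseries_ge0 => j _ _; apply: sume_ge0 => S _.
    by rewrite lee_fin mulr_ge0 ?atom_weight_ge0.
  rewrite -nneseriesZl; last first.
    move=> j _; apply: sume_ge0 => S _.
    by rewrite lee_fin mulr_ge0 ?atom_weight_ge0.
  apply: lee_nneseries => [j _ _|j _].
    rewrite mule_ge0 ?lee_fin ?invr_ge0 ?(ltW D0)//; apply: sume_ge0 => S _.
    by rewrite lee_fin mulr_ge0 ?atom_weight_ge0.
  rewrite ge0_sume_distrr => [|S _]; last first.
    by rewrite lee_fin mulr_ge0 ?atom_weight_ge0.
  rewrite big_seq_cond [leRHS]big_seq_cond; apply: lee_sum => S /andP[SN _].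
  rewrite -EFinM lee_fin mulrC; set a := w i.+1 j.+1 * likelihood x S.
  have a0 : 0 <= a by rewrite mulr_ge0 ?atom_weight_ge0.
  have aD : a <= D by rewrite -lee_fin; exact: den_ge.
  apply: (@le_trans _ _ ((a / D) `^ al)).
    have [aD0|aDn0] := eqVneq (a / D) 0; first by rewrite aD0 powR_ge0.
    have aD1 : 0 < a / D <= 1.
      by rewrite lt_def aDn0 divr_ge0 ?(ltW D0)//= ler_pdivrMr// mul1r.
    by rewrite -[leLHS]powRr1 ?divr_ge0 ?(ltW D0)// ger_powR.
  rewrite ge0_ler_powR ?nnegrE ?divr_ge0 ?(ltW D0) ?(ltW al0) ?(ltW wS1)//.
  by rewrite ler_wpM2l// lef_pV2 ?posrE// -lee_fin.
(* if [D] is infinite its real part is 0, and then so is the posterior *)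
- by rewrite /= invr0 mulr0.
- by rewrite /= invr0 mulr0.
Qed.

End posterior_bound.

(** * Summability of the model weights *)

Section weights.
Variable R : realType.

Lemma ln_ep_ge1 p : (0 < p)%N -> 1 <= ln (expR 1 * p%:R) :> R.
Proof.
move=> p0; rewrite lnM ?posrE ?expR_gt0 ?ltr0n// expRK lerDl.
exact: ln_natr_ge0.
Qed.

Lemma complexity_ge p k s : (0 < p)%N -> (k * s)%:R <= complexity R p k s.
Proof. by move=> p0; rewrite /complexity ler_peMr// ln_ep_ge1. Qed.

Lemma expRN1_le : expR (- 1) <= 2^-1 :> R.
Proof.
rewrite expRN lef_pV2 ?posrE ?expR_gt0//.
by apply: le_trans (expR_ge1Dx _); lra.
Qed.

Lemma nneseries_half : (\sum_(k <oo) ((2^-1 : R) ^+ k)%:E = 2%:E)%E.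
Proof.
apply/cvg_lim => //.
have -> : (fun n => \sum_(0 <= k < n) ((2^-1 : R) ^+ k)%:E)%E =
    EFin \o series (geometric 1 (2^-1 : R)).
  apply/funext => n; rewrite /= /series /= sumEFin; congr (_%:E).
  by apply: eq_bigr => k _; rewrite mul1r.
apply: cvg_EFin; first exact: nearW.
rewrite [X in X @ _ --> _](_ : _ = series (geometric 1 (2^-1 : R)))//.
have e : 2 = 1 * (1 - 2^-1)^-1 :> R by field.
rewrite [X in _ --> X]e.
apply: cvg_geometric_series.
by rewrite ger0_norm// invf_lt1// ltr1n.
Qed.

(** The complexity is at least [(i + 1) (j + 1) >= i + j], and [exp (- 1) <= 1 / 2], so the
    product of two geometric series of sum 2 dominates. *)
Lemma nneseries2_complexity_le p (a : R) : (0 < p)%N -> 1 <= a ->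
  (\sum_(i <oo) \sum_(j <oo) (expR (- a * complexity R p i.+1 j.+1))%:E
   <= 4%:E)%E.
Proof.
move=> p0 a1.
have term i j : expR (- a * complexity R p i.+1 j.+1) <= 2^-1 ^+ i * 2^-1 ^+ j.
  have h : (i + j)%:R <= a * complexity R p i.+1 j.+1.
    apply: (@le_trans _ _ (complexity R p i.+1 j.+1)).
      apply: le_trans (complexity_ge _ _ p0); rewrite ler_nat.
      by rewrite mulSn mulnS addSn addnCA addnA -addnS leq_addr.
    by rewrite ler_peMl// (le_trans _ (complexity_ge _ _ p0)).
  rewrite -exprD; apply: (@le_trans _ _ (expR (- 1) ^+ (i + j))).
    by rewrite -expRM_natl ler_expR mulrN1 mulNr lerN2.
  by rewrite lerXn2r ?nnegrE ?expR_ge0 ?invr_ge0// expRN1_le.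
apply: (@le_trans _ _ (\sum_(i <oo) \sum_(j <oo)
    ((2^-1 : R) ^+ i)%:E * ((2^-1 : R) ^+ j)%:E)%E).
  apply: lee_nneseries => [i _ _|i _].
    by apply: nneseries_ge0 => j _ _; rewrite lee_fin expR_ge0.
  apply: lee_nneseries => [j _ _|j _]; first by rewrite lee_fin expR_ge0.
  by rewrite -EFinM lee_fin.
have -> : (4 = 2 * 2 :> R) by ring.
rewrite EFinM -[X in (_ * X)%E]nneseries_half muleC.
rewrite (eq_eseriesr (g := fun i => (2%:E * ((2^-1 : R) ^+ i)%:E)%E)); last first.
  move=> i _; rewrite nneseriesZl; last by move=> j _; rewrite lee_fin exprn_ge0.
  by rewrite nneseries_half muleC.
rewrite nneseriesZl; last by move=> j _; rewrite lee_fin exprn_ge0.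
by rewrite muleC.
Qed.

(** The total weight has to be finite here: the real part of an infinite one is 0. *)
Lemma total_weight_gt0 p (c : R) : (0 < p)%N -> 1 <= c ->
  0 < fine (total_weight p c).
Proof.
move=> p0 c1; have w0 i j : (0 <= (model_weight p c i j)%:E)%E.
  by rewrite lee_fin expR_ge0.
rewrite /total_weight (nneseries2_shift w0); apply: fine_gt0; apply/andP; split.
  apply: (@lt_le_trans _ _ (model_weight p c 1 1)%:E).
    by rewrite lte_fin expR_gt0.
  by apply: (nneseries2_ge_term (f := fun i j => (model_weight p c i.+1 j.+1)%:E) 0 0) => i j.
by apply: le_lt_trans (nneseries2_complexity_le p0 c1) (ltry _).
Qed.

End weights.

(** * Posterior contraction *)

Section contraction.
Variables (R : realType) (L al k1 k2 : R).
Hypotheses (L1 : 1 < L) (al01 : 0 < al < 1) (k10 : 0 < k1) (k20 : 0 < k2).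
Hypothesis frac : forall n (S0 S S1 : 'M[R]_n),
  loewner L^-1 L S0 -> loewner 1 (1 + L) S -> loewner 1 (1 + L) S1 ->
  let Q := invmx S0 + al *: (invmx S - invmx S1) in
  loewner (2 * (1 + L))^-1 (1 + L) Q /\
  al * (ln (\det (invmx S)) - ln (\det (invmx S1)))
    + ln (\det (invmx S0)) - ln (\det Q)
  <= al * (k2 * fro2 (S1 - S0) - k1 * fro2 (S - S0)).

Let K := entropy_const L.
(** As [al * c = K + 1], the prior pays [K] per unit of complexity for the number of atoms,
    and what is left makes the sum over models converge. *)
Let c := (K + 1) / al.
(** The three summands pay for the distance of the oracle atom to the truth, for the prior
    weight of the oracle model, and for the exponent of the final bound. *)
Let C1 := (6 * k2 + 2 * (c + K) + 2 / al) / k1.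

Let al0 : 0 < al. Proof. by case/andP: al01. Qed.
Let L0 : 0 < L. Proof. exact: lt_trans L1. Qed.
Let K0 : 0 < K. Proof. by rewrite /K /entropy_const; have := sqr_ge0 L; lra. Qed.
Let c1 : 1 <= c.
Proof.
by rewrite /c ler_pdivlMr// mul1r; case/andP: al01 => _ a1; have := K0; lra.
Qed.
Let alc : al * c = K + 1. Proof. by rewrite /c mulrC divfK// gt_eqF. Qed.

Variables (n p : nat).
Hypotheses (n0 : (0 < n)%N) (np : (n <= p)%N).
Variables (Pi : nat -> nat -> probability (mxBorel R p) R).
Variable N : nat -> nat -> seq 'M[R]_p.
Hypothesis sieve : forall k s, (0 < k)%N -> (0 < s)%N ->
  net_prior L n k s (Pi k s) (N k s).

Let p0 : (0 < p)%N. Proof. exact: leq_trans np. Qed.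
Let n0' : 0 < n%:R :> R. Proof. by rewrite ltr0n. Qed.

Let PiE k s : (0 < k)%N -> (0 < s)%N ->
  exists N0 : (0 < size (N k s))%N,
    forall A, measurable A -> Pi k s A = uniform_prior N0 A.
Proof. by move=> k0 s0; case: (sieve k0 s0). Qed.

Let size0 k s : (0 < k)%N -> (0 < s)%N -> 0 < (size (N k s))%:R :> R.
Proof. by move=> k0 s0; have [N0 _] := PiE k0 s0; rewrite ltr0n. Qed.

Let NL k s S : (0 < k)%N -> (0 < s)%N -> S \in N k s -> loewner 1 (1 + L) S.
Proof.
by move=> k0 s0 SN; case: (sieve k0 s0) => _ /(_ _ SN) /(factor_loewner L1).
Qed.

Let model_prior_gt0 k s : 0 < model_prior p c k s.
Proof. by rewrite divr_gt0 ?expR_gt0// total_weight_gt0. Qed.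

Let atom_weight_gt0 k s : (0 < k)%N -> (0 < s)%N -> 0 < atom_weight c N k s.
Proof. by move=> k0 s0; rewrite divr_gt0// size0. Qed.

(** The total weight cancels. The oracle net has at most [expR (K * complexity)] points, the
    other one at least one. *)
Lemma atom_weight_ratio i j k s :
  (0 < i)%N -> (0 < j)%N -> (0 < k)%N -> (0 < s)%N ->
  atom_weight c N i j / atom_weight c N k s <=
  expR (- c * complexity R p i j + (c + K) * complexity R p k s).
Proof.
move=> i0 j0 k0 s0; have T0 := total_weight_gt0 p0 c1.
have [_ _ sb _] := sieve k0 s0.
rewrite /atom_weight /model_prior /model_weight.
have -> : - c * complexity R p i j + (c + K) * complexity R p k s =
  - c * complexity R p i j + K * complexity R p k s - (- c * complexity R p k s).
  by ring.
rewrite expRD expRN [in leRHS]expRD.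
have := size0 i0 j0; have := size0 k0 s0; move: sb.
have : 1 <= (size (N i j))%:R :> R by rewrite ler1n -(ltr0n R) size0.
move: (fine _) T0 (size (N k s))%:R (size (N i j))%:R (expR (K * _)) => T T0 m m' e.
have a0 := expR_gt0 (- c * complexity R p k s).
have b0 := expR_gt0 (- c * complexity R p i j).
move: (expR (- c * complexity R p k s)) (expR (- c * complexity R p i j)) a0 b0.
move=> a b a0 b0 m'1 me m0 m'0.
have -> : b / T / m' / (a / T / m) = b * (m / m') / a.
  by field; rewrite !gt_eqF.
rewrite ler_pM2r ?invr_gt0// ler_pM2l// ler_pdivrMr//.
by apply: (le_trans me); rewrite ler_peMr// (le_trans _ me)// ltW.
Qed.

Lemma complexity_le_rate k s (S0 : 'M[R]_p) :
  complexity R p k s <= n%:R * rate2 L n k s S0.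
Proof.
by rewrite mulrC -ler_pdivrMr// le_max lexx orbT.
Qed.

Lemma rate2_gt0 k s (S0 : 'M[R]_p) : (0 < k)%N -> (0 < s)%N ->
  0 < rate2 L n k s S0.
Proof.
move=> k0 s0; rewrite -(pmulr_rgt0 _ n0').
apply: lt_le_trans (complexity_le_rate k s S0).
by apply: lt_le_trans (complexity_ge R k s p0); rewrite ltr0n muln_gt0 k0.
Qed.

(** A near-minimiser of the bias is at squared distance at most twice the rate from [S0], and
    the net has a point at squared distance at most the rate from it; by
    [(x + y)^2 <= 2 x^2 + 2 y^2] this makes [2 * 1 + 2 * 2]. *)
Lemma exists_oracle_atom k s (S0 : 'M[R]_p) : (0 < k)%N -> (0 < s)%N ->
  exists2 S1, S1 \in N k s & fro2 (S1 - S0) <= 6 * rate2 L n k s S0.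
Proof.
move=> k0 s0; have r0 := rate2_gt0 S0 k0 s0.
pose E := [set frobenius (S - S0) ^+ 2 | S in factor_model L k s].
have infE : has_inf E.
  split; last by exists 0 => _ [S _ <-]; exact: sqr_ge0.
  exists (frobenius (1%:M - S0) ^+ 2); exists 1%:M => //.
  by exists 0; [exact: loading0|rewrite trmx0 mulmx0 add0r].
have [_ [S FS <-] Sinf] := inf_adherent r0 infE.
have infr : inf E <= rate2 L n k s S0 by rewrite le_max lexx.
have [_ _ _ cover] := sieve k0 s0.
have [S1 S1N SS1] := cover S FS; exists S1 => //.
have ksr : (k * s)%:R / n%:R <= rate2 L n k s S0.
  rewrite ler_pdivrMr// mulrC (le_trans _ (complexity_le_rate k s S0))//.
  exact: complexity_ge.
rewrite frobeniusE in Sinf.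
have -> : S1 - S0 = - (S - S1) + (S - S0) by rewrite opprB addrA subrK.
by apply: (le_trans (fro2D _ _)); rewrite fro2N; lra.
Qed.

Section fixed_truth.
Variables (k s : nat) (S0 : 'M[R]_p).
Hypotheses (k0 : (0 < k)%N) (s0 : (0 < s)%N) (S0b : loewner L^-1 L S0).
Variables (d : measure_display) (W : measurableType d) (P : probability W R).
Variable X : 'I_n -> {RV P >-> Rvec R p}.
Hypothesis XS0 : iid_mvnormal X S0.
Variable S1 : 'M[R]_p.
Hypotheses (S1N : S1 \in N k s) (S1S0 : fro2 (S1 - S0) <= 6 * rate2 L n k s S0).

Let r := rate2 L n k s S0.
Let h := complexity R p k s.
Let B : set 'M[R]_p := [set S | factor_models L S /\
  C1 * rate2 L n k s S0 < frobenius (S - S0) ^+ 2].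

Let S1b : loewner 1 (1 + L) S1. Proof. exact: NL S1N. Qed.

Let llr (S : 'M[R]_p) (w : W) : R :=
  al * \sum_i (log_pdf S (X i w) - log_pdf S1 (X i w)).

Let coef i j := expR (al * (- c * complexity R p i j + (c + K) * h)).

Let mllr S : measurable_fun setT (llr S).
Proof.
apply: measurable_funM => //; apply: measurable_sum => i.
apply: measurable_funB; (apply: measurableT_comp; first exact: measurable_log_pdf);
  exact: measurable_funPT.
Qed.

Lemma posterior_le_llr w :
  ((posterior (overall_prior c Pi) (fun i => X i w) B)%:E <=
   \sum_(i <oo) \sum_(j <oo) \sum_(S <- N i.+1 j.+1 | S \in B)
     (coef i.+1 j.+1 * expR (llr S w))%:E)%E.
Proof.
have dS1 := loewner_det_gt0 ltr01 S1b.
have lik1 : 0 < likelihood (fun i => X i w) S1.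
  by rewrite likelihood_expR// expR_gt0.
have al01' : 0 < al <= 1 by rewrite al0 ltW//; case/andP: al01.
have w1 : 0 < atom_weight c N k s * likelihood (fun i => X i w) S1.
  by rewrite mulr_gt0// atom_weight_gt0.
have b := posterior_le_sum PiE B k0 s0 S1N al01' w1.
apply: (le_trans b).
apply: lee_nneseries => [i _ _|i _].
  apply: nneseries_ge0 => j _ _; apply: sume_ge0 => S _.
  by rewrite lee_fin powR_ge0.
apply: lee_nneseries => [j _ _|j _].
  by apply: sume_ge0 => S _; rewrite lee_fin powR_ge0.
rewrite big_seq_cond [leRHS]big_seq_cond; apply: lee_sum => S /andP[SN _].
have dS := loewner_det_gt0 ltr01 (NL (ltn0Sn i) (ltn0Sn j) SN).
rewrite lee_fin !likelihood_expR// -mulf_div -expRN -expRD powRM ?expR_ge0//; last first.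
  by rewrite divr_ge0 ?atom_weight_ge0.
apply: ler_pM; rewrite ?powR_ge0 ?expR_ge0//.
  rewrite /coef [al * _]mulrC expRM ge0_ler_powR ?nnegrE ?expR_ge0 ?(ltW al0)//.
    by rewrite divr_ge0 ?atom_weight_ge0.
  exact: atom_weight_ratio.
by rewrite /llr sumrB [al * _]mulrC expRM.
Qed.

(** On [B], [k1 * fro2 (S - S0)] exceeds [k1 * C1 * r], which by the choice of [C1] is larger
    than the oracle term [6 * k2 * r] by [(2 * (c + K) + 2 / al) * r]. *)
Let integral_llr S : loewner 1 (1 + L) S -> S \in B ->
  (\int[P]_w (expR (llr S w))%:E <=
   (expR (- (n%:R * r) * (al * (c + K) + 1)))%:E)%E.
Proof.
move=> Sb /set_mem [_ SB]; rewrite frobeniusE in SB.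
have [Qb bound] := frac S0b Sb S1b.
have Q0 : 0 < (2 * (1 + L))^-1 by rewrite invr_gt0 mulr_gt0// addr_gt0.
have Qpd := loewner_posdef Q0 Qb.
have S0d : 0 < \det S0 by apply: loewner_det_gt0 S0b; rewrite invr_gt0.
rewrite (expectation_fractional_ratio S0d Qpd XS0) lee_fin ler_expR.
have SB' := ler_wpM2l (ltW k10) (ltW SB).
have k1C : k1 * (C1 * r) = (6 * k2 + 2 * (c + K) + 2 / al) * r.
  by rewrite /C1; field; rewrite !gt_eqF.
rewrite -/r k1C in SB'.
have S1' := ler_wpM2l (ltW k20) S1S0.
have h1 : al * (k2 * fro2 (S1 - S0) - k1 * fro2 (S - S0)) <=
    al * (- (2 * (c + K) + 2 / al) * r).
  by rewrite ler_pM2l//; rewrite -/r in S1'; lra.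
have h2 : al * (- (2 * (c + K) + 2 / al) * r) = - (2 * (al * (c + K) + 1) * r).
  by field; rewrite gt_eqF.
have -> : - (n%:R * r) * (al * (c + K) + 1) =
    n%:R * (- (2 * (al * (c + K) + 1) * r) / 2) by field.
by rewrite ler_pM2l// ler_pM2r ?invr_gt0// -h2 (le_trans bound).
Qed.

Lemma expectation_posterior :
  ('E_P[(fun w => posterior (overall_prior c Pi) (fun i => X i w) B)%R]
   <= (4 * expR (- (n%:R * r)))%:E)%E.
Proof.
rewrite unlock.
pose G w := (\sum_(i <oo) \sum_(j <oo) \sum_(S <- N i.+1 j.+1 | S \in B)
     (coef i.+1 j.+1 * expR (llr S w))%:E)%E.
have t0 i j S w : (0 <= (coef i j * expR (llr S w))%:E)%E.
  by rewrite lee_fin mulr_ge0 ?expR_ge0.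
have mt i j S : measurable_fun setT (fun w => (coef i j * expR (llr S w))%:E).
  apply/measurable_EFinP; apply: measurable_funM => //.
  by apply: measurableT_comp => //; exact: mllr.
have G0 w : (0 <= G w)%E.
  apply: nneseries_ge0 => i _ _; apply: nneseries_ge0 => j _ _.
  by apply: sume_ge0 => S _.
apply: (@le_trans _ _ (\int[P]_w G w)%E).
  apply: ge0_le_integral_patch => // w.
    rewrite /= lee_fin divr_ge0//.
      by apply: fine_ge0; apply: integral_ge0 => S _; rewrite lee_fin likelihood_ge0.
    by apply: fine_ge0; apply: integral_ge0 => S _; rewrite lee_fin likelihood_ge0.
  by rewrite !patch_setT; exact: posterior_le_llr.
have ms i j : measurable_fun setT (fun w =>
    \sum_(S <- N i.+1 j.+1 | S \in B) (coef i.+1 j.+1 * expR (llr S w))%:E)%E.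
  under eq_fun do rewrite -big_filter.
  by apply: emeasurable_sum => S.
have s0' i j w : (0 <= \sum_(S <- N i.+1 j.+1 | S \in B)
    (coef i.+1 j.+1 * expR (llr S w))%:E)%E by apply: sume_ge0.
rewrite integral_nneseries//; last 2 first.
- by move=> i; apply: ge0_emeasurable_sum.
- by move=> i w _; apply: nneseries_ge0.
(* one model: its number of atoms costs [K] and its prior weight gains [K + 1] per unit of
   complexity; the weight of the oracle model is absorbed because [h <= n%:R * r] *)
have bound i j : (\int[P]_w (\sum_(S <- N i.+1 j.+1 | S \in B)
    (coef i.+1 j.+1 * expR (llr S w))%:E) <=
   (expR (- (n%:R * r)))%:E * (expR (- 1 * complexity R p i.+1 j.+1))%:E)%E.
  under eq_integral => w _ do rewrite -big_filter.
  rewrite ge0_integral_sum//.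
  set v := expR (al * (- c * complexity R p i.+1 j.+1 + (c + K) * h) -
    (n%:R * r) * (al * (c + K) + 1)).
  apply: (@le_trans _ _ (\sum_(S <- [seq S <- N i.+1 j.+1 | S \in B]) v%:E)%E).
    rewrite big_seq [leRHS]big_seq; apply: lee_sum => S.
    rewrite mem_filter => /andP[SB SN].
    have mE : measurable_fun setT (fun w => (expR (llr S w))%:E).
      by apply/measurable_EFinP; apply: measurableT_comp => //; exact: mllr.
    under eq_integral do rewrite EFinM.
    rewrite ge0_integralZl ?lee_fin ?expR_ge0//.
    apply: (@le_trans _ _ ((coef i.+1 j.+1)%:E *
        (expR (- (n%:R * r) * (al * (c + K) + 1)))%:E)%E).
      rewrite lee_wpmul2l ?lee_fin ?expR_ge0// integral_llr//.
      exact: NL SN.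
    by rewrite -EFinM lee_fin /coef -expRD /v ler_expR; lra.
  rewrite sumEFin -EFinM lee_fin big_const_seq count_predT iter_addr_0.
  rewrite -[leLHS]mulr_natl -expRD.
  have [_ _ sb _] := sieve (ltn0Sn i) (ltn0Sn j).
  apply: (@le_trans _ _ (expR (K * complexity R p i.+1 j.+1) * v)).
    rewrite ler_wpM2r ?expR_ge0// (le_trans _ sb)// ler_nat.
    by rewrite size_filter count_size.
  rewrite /v -expRD ler_expR.
  have hr : h <= n%:R * r := complexity_le_rate k s S0.
  have acK : 0 <= al * (c + K).
    by rewrite mulr_ge0 ?(ltW al0)// addr_ge0 ?(ltW K0)// (le_trans _ c1).
  have e1 := ler_wpM2l acK hr.
  have e2 : al * (- c * complexity R p i.+1 j.+1 + (c + K) * h) =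
      - (K + 1) * complexity R p i.+1 j.+1 + al * (c + K) * h.
    by rewrite -alc; ring.
  by rewrite e2; lra.
apply: (@le_trans _ _ (\sum_(i <oo) \sum_(j <oo)
   (expR (- (n%:R * r)))%:E * (expR (- 1 * complexity R p i.+1 j.+1))%:E)%E).
  apply: lee_nneseries => [i _ _|i _].
    by apply: integral_ge0 => w _; apply: nneseries_ge0.
  rewrite integral_nneseries//.
  by apply: lee_nneseries => [j _ _|j _]; [exact: integral_ge0|exact: bound].
rewrite (eq_eseriesr (g := fun i => ((expR (- (n%:R * r)))%:E *
   \sum_(j <oo) (expR (- 1 * complexity R p i.+1 j.+1))%:E)%E)); last first.
  by move=> i _; rewrite nneseriesZl// => j _; rewrite lee_fin expR_ge0.
rewrite nneseriesZl; last first.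
  by move=> i _; apply: nneseries_ge0 => j _ _; rewrite lee_fin expR_ge0.
rewrite [4 * _]mulrC [leRHS]EFinM lee_wpmul2l ?lee_fin ?expR_ge0//.
exact: nneseries2_complexity_le.
Qed.

End fixed_truth.
End contraction.

Theorem theorem3p23 (R : realType) (L : R) (hL : 1 < L) :
  exists c C1 C2 : R, [/\ 0 < c, 0 < C1, 0 < C2 &
    forall n p : nat, (0 < n)%N -> (n <= p)%N ->
    exists Pi : nat -> nat -> probability (mxBorel R p) R,
      (forall k s : nat, (0 < k)%N -> (0 < s)%N ->
         sieve_prior (factor_model L k s) (Pi k s)) /\
      forall (k s : nat), (0 < k)%N -> (0 < s)%N ->
      forall S0 : 'M[R]_p, cov_class L S0 ->
      forall (d : measure_display) (W : measurableType d)
             (P : probability W R) (X : 'I_n -> {RV P >-> Rvec R p}),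
        iid_mvnormal X S0 ->
        ('E_P[(fun w => posterior (overall_prior c Pi) (fun i => X i w)
                 [set S | factor_models L S /\
                          C1 * rate2 L n k s S0 < frobenius (S - S0) ^+ 2])%R]
         <= (C2 * expR (- (n%:R * rate2 L n k s S0 / C2)))%:E)%E].
Proof.
have [al [k1 [k2 [al01 k10 k20 frac]]]] := fractional_logdet hL.
have al0 : 0 < al by case/andP: al01.
pose K := entropy_const L.
have K0 : 0 < K by rewrite /K /entropy_const; have := sqr_ge0 L; lra.
have c0 : 0 < (K + 1) / al by rewrite divr_gt0// addr_gt0.
exists ((K + 1) / al), ((6 * k2 + 2 * ((K + 1) / al + K) + 2 / al) / k1), 4.
split => //.
  apply: divr_gt0 => //; apply: addr_gt0; last exact: divr_gt0.
  by apply: addr_gt0; [exact: mulr_gt0|apply: mulr_gt0 => //; exact: addr_gt0].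
move=> n p n0 np.
have /choice[PN PNP] : forall ks : nat * nat,
    exists PN : probability (mxBorel R p) R * seq 'M[R]_p,
    (0 < ks.1)%N -> (0 < ks.2)%N ->
    sieve_prior (factor_model L ks.1 ks.2) PN.1 /\
    net_prior L n ks.1 ks.2 PN.1 PN.2.
  (* index pairs outside the sum defining the prior get an arbitrary measure *)
  move=> [k s] /=; have [k0|k0] := posnP k.
    by exists ((\d_(0 : mxBorel R p) : probability (mxBorel R p) R), [::]); rewrite k0.
  have [s0|s0] := posnP s.
    by exists ((\d_(0 : mxBorel R p) : probability (mxBorel R p) R), [::]); rewrite s0.
  by have [Q [N QN]] := exists_sieve hL n0 np k0 s0; exists (Q, N).
pose Pi k s := (PN (k, s)).1; pose N k s := (PN (k, s)).2.
exists Pi; split=> [k s k0 s0|k s k0 s0 S0 [[symS0 _] eS0] d W P X XS0].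
  by have [] := PNP (k, s) k0 s0.
have sieve i j : (0 < i)%N -> (0 < j)%N -> net_prior L n i j (Pi i j) (N i j).
  by move=> i0 j0; have [] := PNP (i, j) i0 j0.
have S0b : loewner L^-1 L S0 := eigenvalue_loewner symS0 eS0.
have [S1 S1N S1S0] := exists_oracle_atom n0 np sieve S0 k0 s0.
have := expectation_posterior hL al01 k10 k20 frac n0 np sieve k0 s0 S0b XS0 S1N S1S0.
move=> /le_trans; apply; rewrite lee_fin ler_pM2l// ler_expR lerN2.
have nr0 : 0 <= n%:R * rate2 L n k s S0.
  by rewrite mulr_ge0// ltW// (rate2_gt0 L n0 np).
by lra.
Qed.
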